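(* Assume that $X$ admits a birational parametrization without base points. Then there exists $\mathcal{S}\in\mathrm{SolSpace}(\mathcal{P})$ such that $$\deg(\mathcal{S})=\frac{\deg(\mathcal{P})}{\sqrt{\deg(X)}}.$$
   Context: $\mathbb{K}$ is an algebraically closed field of characteristic zero. $X\subset\mathbb{P}^3(\mathbb{K})$ is a rational projective surface of degree $\deg(X)$, and $\mathcal{P}=(p_1:p_2:p_3:p_4):\mathbb{P}^2(\mathbb{K})\dashrightarrow X$ is a fixed non-birational projective rational parametrization of $X$: the $p_i\in\mathbb{K}[t_1,t_2,t_3]$ are homogeneous, the non-zero ones of the same degree, $\gcd(p_1,\ldots,p_4)=1$, $p_4\neq0$, and $\mathcal{P}$ is dominant onto $X$ (hence generically finite) but not birational. For a rational map $\mathcal{M}=(m_1:\cdots:m_{k+1}):\mathbb{P}^2(\mathbb{K})\dashrightarrow\mathbb{P}^k(\mathbb{K})$ whose non-zero $m_i$ are homogeneous of the same degree and with $\gcd(m_1,\dots,m_{k+1})=1$, $\deg(\mathcal{M})$ denotes the common degree of the non-zero $m_i$. The base points of $\mathcal{M}$ are the points of $\mathbb{P}^2(\mathbb{K})$ at which all $m_i$ vanish; ''without base points'' means there are none. A birational parametrization of $X$ is a birational map $\mathbb{P}^2(\mathbb{K})\dashrightarrow X$. The generic fiber of $\mathcal{M}$ is $\mathscr{F}_g(\mathcal{M}):=\{\overline\alpha\in\mathbb{P}^2(\overline{\mathbb{K}(\overline h)})\mid\mathcal{M}(\overline\alpha)=\mathcal{M}(\overline h)\}$, where $\overline h=(h_1,h_2,h_3)$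 is a tuple of independent parameters and $\overline{\mathbb{K}(\overline h)}$ is the algebraic closure of $\mathbb{K}(\overline h)$. $\mathcal{S}\in\mathrm{SolSpace}(\mathcal{P})$ means that $\mathcal{S}=(s_1:s_2:s_3):\mathbb{P}^2(\mathbb{K})\dashrightarrow\mathbb{P}^2(\mathbb{K})$ is a rational map given by forms of the same degree with $\gcd(s_1,s_2,s_3)=1$ and $\mathscr{F}_g(\mathcal{S})=\mathscr{F}_g(\mathcal{P})$. *)

(* Defs.v *)
From HB Require Import structures.
From mathcomp Require Import all_boot all_order all_algebra all_field.
From mathcomp Require Import mpoly.

Set Implicit Arguments.
Unset Strict Implicit.
Unset Printing Implicit Defensive.

Import Order.TTheory GRing.Theory Num.Theory.
Local Open Scope ring_scope.

(* Points of P^n(F) are handled through their homogeneous coordinates, that is,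
   nonzero vectors 'I_n.+1 -> F considered up to proportionality; sets of
   points are predicates on such vectors. *)

Definition nonzero_vec (F : fieldType) (n : nat) (v : 'I_n -> F) : Prop :=
  exists i, v i != 0.

Definition same_point (F : fieldType) (n : nat) (v w : 'I_n -> F) : Prop :=
  exists2 c : F, c != 0 & forall i, v i = c * w i.

Definition eval_forms (F : fieldType) (n k : nat)
    (m : 'I_k -> {mpoly F[n]}) (v : 'I_n -> F) : 'I_k -> F :=
  fun i => (m i).@[v].

Definition coprime_family (F : fieldType) (n k : nat)
    (m : 'I_k -> {mpoly F[n]}) : Prop :=
  forall g : {mpoly F[n]},
    (forall i, exists q, m i = q * g) -> g \is a GRing.unit.

Definition irreducible_mpoly (F : fieldType) (n : nat)
    (f : {mpoly F[n]}) : Prop :=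
  [/\ f != 0, f \isn't a GRing.unit
    & forall g h, f = g * h -> g \is a GRing.unit \/ h \is a GRing.unit].

(* A rational map P^2 --> P^k. The zero polynomial is homogeneous of every
   degree, so ratmap_homog constrains the nonzero components only; coprimality
   excludes that all components vanish, hence ratmap_deg is determined by the
   components. *)
Record ratmap (F : fieldType) (k : nat) := Ratmap {
  ratmap_forms :> 'I_k.+1 -> {mpoly F[3]};
  ratmap_deg : nat;
  ratmap_homog : forall i, ratmap_forms i \is ratmap_deg.-homog;
  ratmap_coprime : coprime_family ratmap_forms
}.

(* An irreducible surface of P^3 is a hypersurface, given by its irreducible
   defining form, and its degree is the degree of that form. *)
Record surface (F : fieldType) := Surface {
  surface_form : {mpoly F[4]};
  surface_deg : nat;
  surface_homog : surface_form \is surface_deg.-homog;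
  surface_irr : irreducible_mpoly surface_form
}.

Definition on_surface (F : fieldType) (X : surface F) (x : 'I_4 -> F) : Prop :=
  nonzero_vec x /\ (surface_form X).@[x] = 0.

Definition defined_at (F : fieldType) (k : nat) (M : ratmap F k)
    (t : 'I_3 -> F) : Prop :=
  nonzero_vec t /\ nonzero_vec (eval_forms M t).

Definition without_base_points (F : fieldType) (k : nat)
    (M : ratmap F k) : Prop :=
  forall t : 'I_3 -> F, nonzero_vec t -> nonzero_vec (eval_forms M t).

(* X is the Zariski closure of the image of M. *)
Definition dominant_onto (F : fieldType) (M : ratmap F 3)
    (X : surface F) : Prop :=
  (forall t, defined_at M t -> on_surface X (eval_forms M t)) /\
  (forall (e : nat) (G : {mpoly F[4]}), G \is e.-homog ->
     (forall t, defined_at M t -> G.@[eval_forms M t] = 0) ->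
     forall x, on_surface X x -> G.@[x] = 0).

(* The rational inverse X --> P^2 is represented by a triple r of forms of the
   same degree. Both composites must be defined somewhere, and must be the
   identity wherever they are defined by the chosen forms. *)
Definition birational_onto (F : fieldType) (M : ratmap F 3)
    (X : surface F) : Prop :=
  dominant_onto M X /\
  exists (e : nat) (r : 'I_3 -> {mpoly F[4]}),
    [/\ forall i, r i \is e.-homog,
        exists2 t, defined_at M t
          & nonzero_vec (eval_forms r (eval_forms M t)),
        forall t, defined_at M t ->
          nonzero_vec (eval_forms r (eval_forms M t)) ->
          same_point (eval_forms r (eval_forms M t)) t,
        exists2 x, on_surface X x & defined_at M (eval_forms r x)
      & forall x, on_surface X x -> defined_at M (eval_forms r x) ->
          same_point (eval_forms M (eval_forms r x)) x].

(* K(h_1, h_2, h_3), and an algebraic closure L of it. *)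
Notation genfield K := {fraction {mpoly K[3]}}.

Definition algebraic_closure (K : fieldType) (L : closedFieldType)
    (iota : {rmorphism genfield K -> L}) : Prop :=
  forall x : L, algebraicOver iota x.

Section GenericFiber.

Variables (K : fieldType) (L : closedFieldType).
Variable iota : {rmorphism genfield K -> L}.

Definition const_emb : K -> L := iota \o (@tofrac {mpoly K[3]}) \o (@mpolyC 3 K).
HB.instance Definition _ := GRing.RMorphism.on const_emb.

Definition generic_point : 'I_3 -> L :=
  fun i => iota (tofrac ('X_i : {mpoly K[3]})).

Definition eval_ext (k : nat) (M : ratmap K k) (a : 'I_3 -> L) : 'I_k.+1 -> L :=
  eval_forms (fun i => map_mpoly const_emb (M i)) a.

(* M(a) = M(h) presupposes that M is defined at a. *)
Definition generic_fiber (k : nat) (M : ratmap K k) (a : 'I_3 -> L) : Prop :=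
  [/\ nonzero_vec a, nonzero_vec (eval_ext M a)
    & same_point (eval_ext M a) (eval_ext M generic_point)].

Definition in_SolSpace (P : ratmap K 3) (S : ratmap K 2) : Prop :=
  forall a : 'I_3 -> L, generic_fiber S a <-> generic_fiber P a.

End GenericFiber.

(* Main.v *)
Require Import Defs.
From HB Require Import structures.
From Stdlib Require Import Classical_Prop.
From mathcomp Require Import all_boot all_order all_algebra all_field.
From mathcomp Require Import mpoly.
From mathcomp Require Import zify.

Set Implicit Arguments.
Unset Strict Implicit.
Unset Printing Implicit Defensive.

Import Order.TTheory GRing.Theory Num.Theory.
Local Open Scope ring_scope.

(** The surface [X] is the image of a birational parametrization [Q] without
    base points.  Let [q] be its degree and let the forms [r] give the inverse
    of [Q].  The solution is [S = Q^-1 o P]: substitute [P] into [r] and remove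
    the common factor [g] of the three forms obtained.

    Degree of [S].  The forms [Q_j(S)] and [P_j] are proportional because [Q]
    and [r] are inverse to each other on [X].  The [P_j] are coprime by
    definition; the [Q_j(S)] are coprime because [Q] has no base points: by the
    projective Nullstellensatz some power of each variable is a combination of
    the [Q_j], so a prime factor common to all [Q_j(S)] would divide every
    [S_i].  Hence [Q(S) = c P] with a constant [c], and
    [deg P = q * deg S] ([composition_lift]).

    Degree of [X].  That [deg X = q^2] is proved by comparing Hilbert functions
    ([degree_eq_square]).  Let [F] be the form of [X] and [d] its degree.  The
    forms of degree [n] in the [Q_j] make up a space of dimension
    ['C(n+3,3) - 'C(n-d+3,3)], which grows like [d n^2 / 2], because the
    relations between the [Q_j] are the multiples of [F]
    ([dominant_kernel]).  This space lies in the space of all forms of degree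
    [q n], whose dimension grows like [q^2 n^2 / 2], so [d <= q^2].  Conversely,
    [r_i(Q) = h t_i] for a form [h]; this makes a fixed power of [h] multiply
    every form of degree [q n] into the algebra of the [Q_j], again thanks to
    the projective Nullstellensatz ([conductor]).  So [q^2 <= d].

    Generic fibers.  Both inclusions are computations with [Q(S) = c P] and
    [r(P) = g S]: for a generic point [b], the first carries [S(a) = S(b)] to
    [P(a) = P(b)], the second carries it back ([same_generic_fiber]).

    Coprimality, and the passage from vanishing on [X] to divisibility by [F],
    need unique factorization in polynomial rings, in the form that every
    nonzero element is a unit times a product of prime elements; it follows from
    the Gauss lemma ([factorial_poly], [factorial_mpoly]). *)

(** * Prime elements and factorial domains *)

Section Factoriality.
Variable R : idomainType.
Implicit Types a b c p x y : R.

Definition divides a b : Prop := exists c, b = c * a.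

Definition prime_element p : Prop :=
  [/\ p != 0, p \isn't a GRing.unit
    & forall a b, divides p (a * b) -> divides p a \/ divides p b].

Inductive factorable : R -> Prop :=
| factorable_unit u : u \is a GRing.unit -> factorable u
| factorable_cons p x : prime_element p -> factorable x -> factorable (p * x).

Definition factorial : Prop := forall x, x != 0 -> factorable x.

Lemma divides_mull a b c : divides a b -> divides a (c * b).
Proof. by case=> d ->; exists (c * d); rewrite mulrA. Qed.

Lemma divides_trans a b c : divides a b -> divides b c -> divides a c.
Proof. by case=> d -> [e ->]; exists (e * d); rewrite mulrA. Qed.

Lemma dividesD a b c : divides a b -> divides a c -> divides a (b + c).
Proof. by case=> d -> [e ->]; exists (d + e); rewrite mulrDl. Qed.

Lemma divides_unit a u : u \is a GRing.unit -> divides a u ->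
  a \is a GRing.unit.
Proof. by move=> Uu [c cE]; move: Uu; rewrite cE unitrM => /andP[]. Qed.

Lemma prime_divides_exp p a n : prime_element p -> divides p (a ^+ n) ->
  divides p a.
Proof.
move=> pp; elim: n => [|n IHn].
  by case: pp => _ nUp _ /(divides_unit (unitr1 R)); rewrite (negbTE nUp).
by rewrite exprS; case: pp => _ _ pp /pp [].
Qed.

Lemma factorableM x y : factorable x -> factorable y -> factorable (x * y).
Proof.
move=> fx fy; elim: fx => [u Uu|p z pp _ IH]; last first.
  by rewrite -mulrA; apply: factorable_cons.
elim: fy => [v Uv|p z pp _ IH].
  by apply: factorable_unit; rewrite unitrM Uu.
by rewrite mulrCA; apply: factorable_cons.
Qed.

Lemma factorable_prime_or_unit x : factorable x ->
  x \is a GRing.unit \/ exists2 p, prime_element p & divides p x.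
Proof.
case=> [u Uu|p z pp _]; first by left.
by right; exists p => //; exists z; rewrite mulrC.
Qed.

(** The factorization of an irreducible element has a single prime factor. *)
Lemma irreducible_prime : factorial -> forall x, x != 0 ->
  x \isn't a GRing.unit ->
  (forall a b, x = a * b -> a \is a GRing.unit \/ b \is a GRing.unit) ->
  prime_element x.
Proof.
move=> ufdR x nz_x nUx irr; have fx := ufdR x nz_x.
case: fx nz_x nUx irr.
  by move=> u Uu _; rewrite Uu.
move=> p z pp _ nz nUx /(_ _ _ erefl) [Up|Uz].
  by case: pp; rewrite Up.
split=> // a b [c abE].
case: (pp) => _ _ /(_ a b) [|[d dE]|[d dE]].
- by exists (c * z); rewrite abE -mulrA (mulrC p).
- by left; exists (d * z^-1); rewrite dE mulrA mulrAC mulrVK.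
- by right; exists (d * z^-1); rewrite dE mulrA mulrAC mulrVK.
Qed.

(** A proportionality with a coprime family [a] can be cleared: a prime factor
    of [x] cannot divide all the [a i], hence divides [y], and cancels. *)
Lemma proportional_coprime_divides (I : Type) (a b : I -> R) x y :
  factorial -> x != 0 ->
  (forall g, (forall i, divides g (a i)) -> g \is a GRing.unit) ->
  (forall i, x * b i = y * a i) -> divides x y.
Proof.
move=> ufdR nz_x cop_a; elim: (ufdR x nz_x) y => [u Uu|p z pp _ IH] y xy.
  by exists (y / u); rewrite mulrVK.
have [nz_p nUp pP] := pp.
have py : divides p y.
  apply: NNPP => npy; move: nUp; rewrite (cop_a p) // => i.
  case: (pP y (a i)) => //; exists (z * b i).
  by rewrite -xy -mulrA mulrC.
case: py xy => k -> xy.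
case: (IH k) => [i|l ->]; last by exists l; rewrite -mulrA (mulrC z).
by apply: (mulfI nz_p); rewrite !mulrA xy (mulrC p).
Qed.

End Factoriality.

Section FactorialIso.
Variables (R S : idomainType) (f : {rmorphism R -> S}) (g : {rmorphism S -> R}).
Hypotheses (fK : cancel f g) (gK : cancel g f).

Lemma divides_rmorph (A B : idomainType) (h : {rmorphism A -> B}) a b :
  divides a b -> divides (h a) (h b).
Proof. by case=> c ->; exists (h c); rewrite rmorphM. Qed.

Lemma prime_element_iso p : prime_element p -> prime_element (f p).
Proof.
case=> nz_p nUp pP; split.
- by apply: contraNneq nz_p => fp0; rewrite -(fK p) fp0 rmorph0.
- by apply: contra nUp => /(rmorph_unit g); rewrite fK.
move=> a b /(divides_rmorph g); rewrite rmorphM fK => /pP.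
by case=> /(divides_rmorph f); rewrite gK; [left|right].
Qed.

Lemma factorial_iso : factorial R -> factorial S.
Proof.
move=> ufdR x nz_x; rewrite -[x]gK.
have: g x != 0 by apply: contraNneq nz_x => gx0; rewrite -(gK x) gx0 rmorph0.
move/ufdR; elim=> [u Uu|p z pp _ IH]; first exact/factorable_unit/rmorph_unit.
by rewrite rmorphM; apply: factorable_cons => //; apply: prime_element_iso.
Qed.

End FactorialIso.

(** [gcdp] is a gcd over the fraction field of [R]; clearing denominators in a
    Bezout relation leaves a nonzero constant of [R]. *)
Lemma gcd_const_bezout (R : idomainType) (f g : {poly R}) :
  size (gcdp f g) = 1%N -> exists c u v, c != 0 /\ c%:P = u * f + v * g.
Proof.
move=> /eqP/size_poly1P [c nz_c eE]; have [[u v] /= ] := Bezoutp f g.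
move/eqpP => [[c1 c2] /= /andP[nz1 nz2]]; rewrite eE => uvE.
exists (c2 * c), (c1%:P * u), (c1%:P * v); split; first by rewrite mulf_neq0.
by rewrite polyCM mul_polyC -uvE -!mulrA -mulrDr mul_polyC.
Qed.

(** A prime of positive degree remains irreducible over the fraction field, so
    it is coprime there to every polynomial that it does not divide. *)
Lemma prime_not_divides_const_bezout (R : idomainType) (f g : {poly R}) :
  prime_element f -> (1 < size f)%N -> ~ divides f g ->
  exists c u v, c != 0 /\ c%:P = u * f + v * g.
Proof.
move=> [nz_f _ fP] sf nfg; apply: gcd_const_bezout; set e := gcdp f g.
have not_const (d : R) : d != 0 -> ~ divides f d%:P.
  move=> nz_d [k dE]; have nz_k : k != 0.
    by apply: contraNneq nz_d => k0; rewrite -polyC_eq0 dE k0 mul0r.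
  have := size_mul nz_k nz_f; rewrite -dE size_polyC nz_d.
  by have := size_poly_gt0 k; rewrite nz_k; lia.
have /Pdiv.Idomain.dvdpP [[d l] /= nz_d dE] : e %| f := dvdp_gcdl f g.
rewrite -mul_polyC in dE; case: (fP l e) => [|[m lE]|[m eE]].
- by exists d%:P; rewrite dE.
- have dme : d%:P = m * e by apply: (mulIf nz_f); rewrite dE lE mulrAC.
  have /andP[nz_m nz_e] : (m != 0) && (e != 0).
    by rewrite -negb_or -mulf_eq0 -dme polyC_eq0.
  have := size_mul nz_m nz_e; rewrite -dme size_polyC nz_d.
  have := size_poly_gt0 m; have := size_poly_gt0 e; rewrite nz_m nz_e.
  by case: (size m) (size e) => [|a] [|b] //=; lia.
have /Pdiv.Idomain.dvdpP [[d' k] /= nz_d' d'E] : e %| g := dvdp_gcdr f g.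
case: (fP d'%:P g) => [|/not_const|//].
  by exists (k * m); rewrite mul_polyC d'E eE mulrA.
by rewrite nz_d'; case.
Qed.

(** * The Gauss lemma *)

Section GaussLemma.
Variable R : idomainType.
Hypothesis ufdR : factorial R.
Implicit Types f g h : {poly R}.

Lemma dividesCP (p : R) f : divides p%:P f <-> forall i, divides p f`_i.
Proof.
split=> [[c ->] i|pf]; first by exists c`_i; rewrite coefMC.
elim/poly_ind: f pf => [|f c IH] pf; first by exists 0; rewrite mul0r.
apply: dividesD.
  rewrite mulrC; apply: divides_mull; apply: IH => i.
  by have := pf i.+1; rewrite coefD coefMX coefC /= addr0.
have := pf 0; rewrite coefD coefMX coefC /= add0r => -[d ->].
by exists d%:P; rewrite polyCM.
Qed.

Lemma dividesC_mulX_add (p : R) f (c : R) :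
  divides p%:P (f * 'X + c%:P) <-> divides p%:P f /\ divides p c.
Proof.
split.
  move/dividesCP=> pf; split.
    apply/dividesCP => i; have := pf i.+1.
    by rewrite coefD coefMX coefC /= addr0.
  by have := pf 0; rewrite coefD coefMX coefC /= add0r.
case=> pf [d ->]; apply: dividesD; first by rewrite mulrC; apply: divides_mull.
by exists d%:P; rewrite polyCM.
Qed.

(** If [p] divides a product, it divides the product of the constant terms, so
    one of these terms; that term can be subtracted, and the variable divided
    out, which gives an induction on the two factors. *)
Lemma prime_element_polyC (p : R) : prime_element p -> prime_element p%:P.
Proof.
case=> nz_p nUp pP; split; first by rewrite polyC_eq0.
  by apply: contra nUp; rewrite poly_unitE size_polyC coefC => /andP[].
have sub a b : divides p%:P (a + b) -> divides p%:P a -> divides p%:P b.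
  move=> [u uE] [v vE]; exists (u - v).
  by rewrite mulrBl -uE -vE addrC addKr.
have divXr a : divides p%:P (a * 'X) -> divides p%:P a.
  by rewrite -[a * 'X]addr0 -polyC0 => /dividesC_mulX_add [].
elim/poly_ind=> [|f c IHf] g; first by left; exists 0; rewrite mul0r.
elim/poly_ind: g => [|g d IHg]; first by right; exists 0; rewrite mul0r.
move=> pfg; have : divides p (c * d).
  move/dividesCP/(_ 0): pfg; rewrite coef0M !coefD !coefMX !coefC /=.
  by rewrite !add0r.
case/pP => pc.
  case: (IHf (g * 'X + d%:P)); last by right.
    apply: divXr; apply: (sub (c%:P * (g * 'X + d%:P))).
      by move: pfg; rewrite mulrDl addrC mulrAC.
    case: pc => e ->; exists (e%:P * (g * 'X + d%:P)).
    by rewrite polyCM mulrAC.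
  by left; apply/dividesC_mulX_add.
have pfg' : divides p%:P ((f * 'X + c%:P) * g).
  apply: divXr; apply: (sub ((f * 'X + c%:P) * d%:P)).
    by move: pfg; rewrite mulrDr addrC mulrA.
  by case: pc => e ->; exists ((f * 'X + c%:P) * e%:P); rewrite polyCM mulrA.
case: (IHg pfg') => [|pg]; first by left.
by right; apply/dividesC_mulX_add.
Qed.

Lemma polyC_prime_element (p : R) : prime_element p%:P -> prime_element p.
Proof.
case=> nz_p nUp pP; split; first by rewrite -polyC_eq0.
  by apply: contra nUp => /(rmorph_unit polyC).
move=> a b [c abE]; case: (pP a%:P b%:P).
- by exists c%:P; rewrite -!polyCM abE.
- by move/dividesCP/(_ 0%N); rewrite coefC; left.
- by move/dividesCP/(_ 0%N); rewrite coefC; right.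
Qed.

(** Each prime factor of [d] is prime in [{poly R}] too, so it divides [g] or
    [h] and can be cancelled: factorizations over the fraction field descend to
    [R]. *)
Lemma clear_denominator (d : R) f g h : d != 0 -> d%:P * f = g * h ->
  exists g' h', [/\ f = g' * h', size g' = size g & size h' = size h].
Proof.
move/ufdR => fd; elim: fd f g h => [u Uu|p z pp _ IH] f g h.
  move=> fE; exists (u^-1%:P * g), h; split=> //.
    by rewrite -mulrA -fE mulrA -polyCM mulVr // mul1r.
  by rewrite size_Cmul ?invr_eq0 //; apply: contraTneq Uu => ->; rewrite unitr0.
have nz_p : p != 0 by case: pp.
have nz_pP : p%:P != 0 by rewrite polyC_eq0.
rewrite polyCM => fE; case: (prime_element_polyC pp) => _ _ /(_ g h) [].
- by rewrite -fE; exists (z%:P * f); rewrite -mulrA mulrC.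
- case=> k gE; have [|g' [h' [-> sg sh]]] := IH f k h.
    by apply: (mulfI nz_pP); rewrite mulrA fE gE (mulrC k) mulrA.
  by exists g', h'; split=> //; rewrite sg gE mulrC size_Cmul.
case=> k hE; have [|g' [h' [-> sg sh]]] := IH f g k.
  by apply: (mulfI nz_pP); rewrite mulrA fE hE (mulrC k) mulrCA.
by exists g', h'; split=> //; rewrite sh hE mulrC size_Cmul.
Qed.

Definition primitive f : Prop :=
  forall p : R, prime_element p -> ~ divides p%:P f.

Lemma primitive_divides (d : R) f g : d != 0 -> primitive f ->
  divides f (d%:P * g) -> divides f g.
Proof.
move=> /ufdR fd prim; elim: fd g => [u Uu|p z pp _ IH] g [k kE].
  by exists (u^-1%:P * k); rewrite -mulrA -kE mulrA -polyCM mulVr // mul1r.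
have nz_p : p%:P != 0 by rewrite polyC_eq0; case: pp.
case: (prime_element_polyC pp) => _ _ /(_ k f) [].
- by exists (z%:P * g); rewrite -kE polyCM -mulrA mulrC.
- case=> l lE; apply: IH; exists l; apply: (mulfI nz_p).
  by rewrite [LHS]mulrA -polyCM kE lE (mulrC l) mulrA.
by move/(prim p pp).
Qed.

(** The induction runs over the prime factors of a multiple [y] of all constant
    divisors of [f], initially the leading coefficient.  The next prime factor
    of [y] is either divided out of [f], or divides no constant divisor of [f]
    and is dropped from [y]. *)
Lemma primitive_part f : f != 0 ->
  exists c f', [/\ c != 0, primitive f' & f = c%:P * f'].
Proof.
move=> nz_f; suff [y fy yP] : exists2 y, factorable y
    & forall c, divides c%:P f -> divides c y.
  elim: fy f nz_f yP => [u Uu|p z pp _ IH] {}f nz_f fP.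
    exists 1, f; split; rewrite ?oner_eq0 ?polyC1 ?mul1r // => p pp /fP.
    by move/(divides_unit Uu); case: pp => _ /negbTE->.
  have [[nz_p nUp pP] nz_pP] : prime_element p /\ p%:P != 0.
    by split=> //; rewrite polyC_eq0; case: pp.
  case: (classic (divides p%:P f)) => [[g gE]|npf].
    have [||c [f' [nz_c prim g'E]]] := IH g.
    - by apply: contraNneq nz_f => g0; rewrite gE g0 mul0r.
    - move=> c [k kE]; case: (fP (p * c)) => [|l lE].
        by exists k; rewrite gE kE polyCM -mulrA (mulrC c%:P).
      by exists l; apply: (mulfI nz_p); rewrite lE mulrCA.
    by exists (c * p), f'; split; rewrite ?mulf_neq0 // gE g'E polyCM mulrAC.
  apply: IH => // c cf; case: (fP c cf) => k kE.
  case: (pP k c) => [||[c' cE]].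
  - by exists z; rewrite -kE mulrC.
  - case=> l lE; exists l; apply: (mulfI nz_p).
    by rewrite kE lE mulrA (mulrC p).
  by case: npf; apply: divides_trans cf; exists c'%:P; rewrite cE polyCM.
exists (lead_coef f); first by apply: ufdR; rewrite lead_coef_eq0.
by move=> c /dividesCP; apply.
Qed.

(** The hypothesis on [d], [g], [h] says that [f] is irreducible over the
    fraction field. If [f] is not a divisor of [g] there, a Bezout relation
    shows that it divides the other factor, up to a constant; constants are
    harmless for a primitive polynomial. *)
Lemma primitive_irreducible_prime f : primitive f -> (1 < size f)%N ->
  (forall d g h, d != 0 -> d%:P * f = g * h -> size g = 1%N \/ size h = 1%N) ->
  prime_element f.
Proof.
move=> prim sf irr; have nz_f : f != 0 by rewrite -size_poly_gt0 ltnW.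
split=> //; first by rewrite poly_unitE; case: eqP sf => // ->.
move=> g h [k kE]; pose e := gcdp f g.
have /Pdiv.Idomain.dvdpP [[d l] /= nz_d dE] : e %| f := dvdp_gcdl f g.
have {}dE : d%:P * f = l * e by rewrite mul_polyC.
case: (irr d l e nz_d dE) => [/eqP/size_poly1P[c nz_c lE]|se].
  left; have /Pdiv.Idomain.dvdpP [[d' k'] /= nz_d' d'E] : e %| g :=
    dvdp_gcdr f g.
  apply: (@primitive_divides (c * d')); rewrite ?mulf_neq0 //.
  exists (k' * d%:P); rewrite polyCM -mulrA mul_polyC mul_polyC d'E.
  by rewrite -mulrA dE lE -mul_polyC mulrCA.
right; have [c [u [v [nz_c cE]]]] := gcd_const_bezout se.
apply: (primitive_divides nz_c prim); rewrite cE mulrDl; apply: dividesD.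
  by exists (u * h); rewrite mulrAC.
by exists (v * k); rewrite -!mulrA kE.
Qed.

Theorem factorial_poly : factorial {poly R}.
Proof.
move=> f; have [n] := ubnP (size f); elim: n f => // n IH f sf nz_f.
have fact_polyC (c : R) : c != 0 -> factorable c%:P.
  move/ufdR; elim=> [u Uu|p z pp _ fz]; first exact/factorable_unit/rmorph_unit.
  by rewrite polyCM; apply: factorable_cons => //; apply: prime_element_polyC.
have [c [f' [nz_c prim fE]]] := primitive_part nz_f.
rewrite fE; apply: factorableM; first exact: fact_polyC.
have sf' : size f' = size f by rewrite fE size_Cmul.
have nz_f' : f' != 0 by rewrite -size_poly_gt0 sf' size_poly_gt0.
case: (leqP (size f') 1%N) => [s1|s1].
  rewrite (size1_polyC s1); apply: fact_polyC.
  by apply: contraNneq nz_f' => z; rewrite (size1_polyC s1) z.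
case: (classic (exists d g h,
    [/\ d != 0, d%:P * f' = g * h, (1 < size g)%N & (1 < size h)%N])).
  case=> d [g [h [nz_d dE sg sh]]].
  have [g' [h' [f'E sg' sh']]] := clear_denominator nz_d dE.
  have nz_g' : g' != 0 by rewrite -size_poly_gt0 sg' ltnW.
  have nz_h' : h' != 0 by rewrite -size_poly_gt0 sh' ltnW.
  have := size_mul nz_g' nz_h'; rewrite -f'E sf' sg' sh' => sE.
  rewrite f'E; apply: factorableM; apply: IH => //.
    by move: sf; rewrite sE sg'; lia.
  by move: sf; rewrite sE sh'; lia.
move=> irr; rewrite -[f']mulr1; apply: factorable_cons.
  apply: primitive_irreducible_prime => // d g h nz_d dE.
  have : g * h != 0 by rewrite -dE mulf_neq0 ?polyC_eq0.
  rewrite mulf_eq0 negb_or -!size_poly_gt0 => /andP[sg sh].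
  case: (ltnP 1 (size g)) => [sg1|]; last by left; lia.
  case: (ltnP 1 (size h)) => [sh1|]; last by right; lia.
  by case: irr; exists d, g, h.
exact/factorable_unit/unitr1.
Qed.

End GaussLemma.

(** * Factoriality of polynomial rings in several variables *)

Lemma mpoly_rmorph_eq (R : comNzRingType) (S : nzRingType) n
    (f g : {rmorphism {mpoly R[n]} -> S}) :
  (forall c, f c%:MP = g c%:MP) -> (forall i, f 'X_i = g 'X_i) -> f =1 g.
Proof.
move=> fC fX p; rewrite (mpolyE p) !rmorph_sum; apply: eq_bigr => m _.
rewrite -mul_mpolyC !rmorphM /= fC mpolyXE_id !rmorph_prod; congr (_ * _).
by apply: eq_bigr => i _; rewrite !rmorphXn /= fX.
Qed.

Section LastVariable.
Variables (n : nat) (K : fieldType).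

Lemma lift_max_widen (i : 'I_n) : lift ord_max i = widen_ord (leqnSn n) i.
Proof. by apply/val_inj; rewrite /= /bump leqNgt ltn_ord. Qed.

Lemma muni_last : muni ('X_ord_max : {mpoly K[n.+1]}) = 'X.
Proof.
rewrite muniE msuppX big_seq1 mcoeffX eqxx scale1r mnm1E eqxx expr1.
rewrite (_ : [multinom _ | i < n] = 0%MM) ?mpolyX0 ?scale1r //.
apply/mnmP => i; rewrite mnmE mnm1E mnm0E -lift_max_widen.
by rewrite (negbTE (neq_lift _ _)).
Qed.

Lemma muni_lift (i : 'I_n) :
  muni ('X_(lift ord_max i) : {mpoly K[n.+1]}) = ('X_i)%:P.
Proof.
rewrite muniE msuppX big_seq1 mcoeffX eqxx scale1r mnm1E eq_sym.
rewrite (negbTE (neq_lift _ _)) expr0 alg_polyC; congr ('X_[_])%:P.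
by apply/mnmP => j; rewrite mnmE !mnm1E -lift_max_widen (inj_eq lift_inj).
Qed.

Definition of_muni : {poly {mpoly K[n]}} -> {mpoly K[n.+1]} :=
  horner_eval 'X_ord_max \o map_poly (@mwiden n K).

HB.instance Definition _ := GRing.RMorphism.on of_muni.

Lemma of_muniC c : of_muni c%:P = mwiden c.
Proof. by rewrite /of_muni /= map_polyC /= /horner_eval hornerC. Qed.

Lemma muniK : cancel (@muni n K) of_muni.
Proof.
apply: (mpoly_rmorph_eq (f := of_muni \o @muni n K) (g := idfun)) => [c|i] /=.
  by rewrite muniC of_muniC mwidenC.
case: (unliftP ord_max i) => [j|] ->.
  by rewrite muni_lift of_muniC mwidenX mnmwiden1 lift_max_widen.
by rewrite muni_last /of_muni /= map_polyX /horner_eval hornerX.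
Qed.

Lemma of_muniK : cancel of_muni (@muni n K).
Proof.
have mw (p : {mpoly K[n]}) : muni (mwiden p) = p%:P.
  apply: (mpoly_rmorph_eq (f := @muni n K \o @mwiden n K) (g := polyC)) p.
    by move=> c /=; rewrite mwidenC muniC.
  by move=> i /=; rewrite mwidenX mnmwiden1 -lift_max_widen muni_lift.
elim/poly_ind => [|p c IH]; first by rewrite !raddf0.
rewrite [of_muni _]raddfD raddfD /= of_muniC mw rmorphM; congr (_ + _).
rewrite rmorphM /= IH; congr (_ * _).
by rewrite /of_muni /= map_polyX /horner_eval hornerX muni_last.
Qed.

Definition extend_point (v : 'I_n -> K) (b : K) : 'I_n.+1 -> K :=
  fun i => if unlift ord_max i is Some j then v j else b.

Lemma meval_extend (p : {mpoly K[n.+1]}) v b :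
  p.@[extend_point v b] = (map_poly (meval v) (muni p)).[b].
Proof.
apply: (mpoly_rmorph_eq (f := meval (extend_point v b))
  (g := horner_eval b \o map_poly (meval v) \o @muni n K)) p => [c|i] /=.
  by rewrite mevalC muniC map_polyC /= /horner_eval hornerC mevalC.
rewrite mevalXU /extend_point; case: (unliftP ord_max i) => [j|] -> /=.
  by rewrite muni_lift map_polyC /= /horner_eval hornerC mevalXU.
by rewrite muni_last map_polyX /horner_eval hornerX.
Qed.

End LastVariable.

Lemma mpoly_field_unit (K : fieldType) n (c : K) : c != 0 ->
  c%:MP_[n] \is a GRing.unit.
Proof. by move=> nz_c; apply: rmorph_unit; rewrite unitfE. Qed.

Lemma mpoly_msize_le1_unit (K : fieldType) n (p : {mpoly K[n]}) :
  p != 0 -> (msize p <= 1)%N -> p \is a GRing.unit.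
Proof.
move=> nz_p /msize1_polyC pE; rewrite pE; apply: mpoly_field_unit.
by apply: contraNneq nz_p => c0; rewrite pE c0 mpolyC0.
Qed.

Lemma mpoly0_unit (K : fieldType) (p : {mpoly K[0]}) : p != 0 ->
  p \is a GRing.unit.
Proof.
move=> nz_p; apply: mpoly_msize_le1_unit => //; rewrite msizeE.
by apply/bigmax_leqP_seq => m _ _; rewrite mdegE big_ord0.
Qed.

Theorem factorial_mpoly (K : fieldType) n : factorial {mpoly K[n]}.
Proof.
elim: n => [|n IH]; first by move=> p /mpoly0_unit; left.
exact: (@factorial_iso {poly {mpoly K[n]}} {mpoly K[n.+1]} (@of_muni n K)
  (@muni n K) (@of_muniK n K) (@muniK n K) (factorial_poly IH)).
Qed.

Lemma prime_element_muni (K : fieldType) n (p : {mpoly K[n.+1]}) :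
  prime_element p -> prime_element (muni p).
Proof.
exact: (@prime_element_iso {mpoly K[n.+1]} {poly {mpoly K[n]}} (@muni n K)
  (@of_muni n K) (@muniK n K) (@of_muniK n K) p).
Qed.

Lemma divides_muni (K : fieldType) n (p q : {mpoly K[n.+1]}) :
  divides (muni p) (muni q) -> divides p q.
Proof.
by case=> c cE; exists (of_muni c); rewrite -(muniK q) cE rmorphM /= muniK.
Qed.

(** * Polynomials vanishing on a hypersurface *)

Section Vanishing.
Variable K : closedFieldType.

(** Specialize the coefficients where the leading one does not vanish, then
    avoid the finitely many roots in the last variable. *)
Lemma mpoly_nonroot n (p : {mpoly K[n]}) : p != 0 -> exists v, p.@[v] != 0.
Proof.
elim: n p => [|n IH] p nz_p.
  exists (fun=> 0); rewrite -unitfE.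
  exact: (rmorph_unit (meval _) (mpoly0_unit nz_p)).
have: muni p != 0 by rewrite -(inj_eq (can_inj (@muniK n K))) raddf0 in nz_p *.
rewrite -lead_coef_eq0 => /IH[v nzv].
have: map_poly (meval v) (muni p) != 0.
  rewrite -size_poly_eq0 size_map_poly_id0 // size_poly_eq0 -lead_coef_eq0.
  by apply: contraNneq nzv => ->; rewrite meval0.
move/closed_nonrootP=> [b nz]; exists (extend_point v b).
by rewrite meval_extend.
Qed.

Lemma mpoly_eq_points n (p q : {mpoly K[n]}) :
  (forall v, p.@[v] = q.@[v]) -> p = q.
Proof.
move=> pq; apply/eqP; rewrite -subr_eq0; apply: contraT => /mpoly_nonroot[v].
by rewrite mevalB pq subrr eqxx.
Qed.

Lemma vanishing_poly_eq0 (p : {poly K}) : (forall b, p.[b] = 0) -> p = 0.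
Proof.
move=> p0; apply/eqP; apply: contraT => /closed_nonrootP[b].
by rewrite /root p0 eqxx.
Qed.

Lemma bezout_eval (R : nzRingType) (e : {rmorphism R -> K}) c
    (u f w g : {poly R}) x :
  c%:P = u * f + w * g -> (map_poly e f).[x] = 0 -> (map_poly e g).[x] = 0 ->
  e c = 0.
Proof.
move=> cE fx gx; have := congr1 (fun p => (map_poly e p).[x]) cE.
rewrite /= rmorphD !rmorphM /= hornerD !hornerM fx gx !mulr0 addr0.
by rewrite map_polyC hornerC.
Qed.

(** The Nullstellensatz for a hypersurface, by induction on the number of
    variables. If [f] does not involve the last variable, the induction applies
    to each coefficient of [g]. Otherwise, if [f] does not divide [g], some
    nonzero [c] free of the last variable is a combination of [f] and [g]. At a
    point where neither [c] nor the leading coefficient of [f] vanishes, [f] has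
    a root in the last variable, and [g] does not vanish there. *)
Theorem prime_nullstellensatz n (f g : {mpoly K[n]}) :
  prime_element f -> (forall v, f.@[v] = 0 -> g.@[v] = 0) -> divides f g.
Proof.
elim: n f g => [|n IH] F G pF FG.
  by case: pF => /mpoly0_unit ->.
set f := muni F; set g := muni G.
have pf : prime_element f.
  exact: prime_element_muni.
apply: divides_muni; rewrite -/f -/g.
have fg v b : (map_poly (meval v) f).[b] = 0 -> (map_poly (meval v) g).[b] = 0.
  by have := FG (extend_point v b); rewrite !meval_extend.
case: (leqP (size f) 1%N) => [/size1_polyC fC|sf].
  rewrite fC; set c := f`_0; apply/dividesCP => i.
  have pc : prime_element c.
    by apply: polyC_prime_element; rewrite -fC.
  apply: IH => // v cv; rewrite -coef_map /=.
  rewrite [map_poly _ _]vanishing_poly_eq0 ?coef0 // => b; apply: fg.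
  by rewrite fC map_polyC /= -/c cv hornerC.
apply: NNPP => nfg; have [c [a [b [nz_c cE]]]] :=
  prime_not_divides_const_bezout pf sf nfg.
have nz_f : f != 0 by case: pf.
have [v] : exists v, (c * lead_coef f).@[v] != 0.
  by apply: mpoly_nonroot; rewrite mulf_neq0 ?lead_coef_eq0.
rewrite mevalM mulf_eq0 negb_or => /andP[cv lv].
have : size (map_poly (meval v) f) != 1%N.
  by rewrite size_map_poly_id0 ?neq_ltn ?sf ?orbT.
move/closed_rootP=> [x /eqP fx]; case/eqP: cv.
apply: (bezout_eval (e := meval v) cE fx); exact: fg.
Qed.

End Vanishing.

(** * Substitution and homogeneous polynomials *)

Section Substitution.
Variables (K : fieldType) (n k : nat).
Implicit Types (s : 'I_k -> {mpoly K[n]}) (p : {mpoly K[k]}).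

Definition subst s p : {mpoly K[n]} := p \mPo [tuple s i | i < k].

HB.instance Definition _ s :=
  GRing.RMorphism.copy (subst s) (comp_mpoly [tuple s i | i < k]).

Lemma substC s c : subst s c%:MP = c%:MP.
Proof. exact: comp_mpolyC. Qed.

Lemma substX s i : subst s 'X_i = s i.
Proof. by rewrite /subst comp_mpolyXU -tnth_nth tnth_mktuple. Qed.

Lemma substZ s c p : subst s (c *: p) = c *: subst s p.
Proof. exact: comp_mpolyZ. Qed.

Lemma meval_subst s p v : (subst s p).@[v] = p.@[fun i => (s i).@[v]].
Proof.
by rewrite comp_mpoly_meval; apply: meval_eq => i; rewrite tnth_mktuple.
Qed.

Lemma map_subst (L : fieldType) (e : {rmorphism K -> L}) s p (a : 'I_n -> L) :
  (map_mpoly e (subst s p)).@[a] =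
  (map_mpoly e p).@[fun i => (map_mpoly e (s i)).@[a]].
Proof.
apply: (mpoly_rmorph_eq (f := meval a \o map_mpoly e \o subst s)
  (g := meval (fun i => (map_mpoly e (s i)).@[a]) \o map_mpoly e)) p.
  by move=> c /=; rewrite substC !map_mpolyC !mevalC.
by move=> i /=; rewrite substX map_mpolyX mevalXU.
Qed.

End Substitution.

Lemma subst_subst (K : fieldType) n k l (s : 'I_k -> {mpoly K[n]})
    (r : 'I_l -> {mpoly K[k]}) p :
  subst s (subst r p) = subst (fun i => subst s (r i)) p.
Proof.
apply: (mpoly_rmorph_eq (f := subst s \o subst r)
  (g := subst (fun i => subst s (r i)))) p.
  by move=> c /=; rewrite !substC.
by move=> i /=; rewrite !substX.
Qed.

Lemma eq_subst (K : fieldType) n k (s r : 'I_k -> {mpoly K[n]}) p :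
  s =1 r -> subst s p = subst r p.
Proof.
move=> sr; apply: (mpoly_rmorph_eq (f := subst s) (g := subst r)) p.
  by move=> c /=; rewrite !substC.
by move=> i /=; rewrite !substX.
Qed.

Lemma mpolyU_neq0 (K : fieldType) n (i : 'I_n) : 'X_i != 0 :> {mpoly K[n]}.
Proof. by rewrite -msize_poly_eq0 msizeX. Qed.

Lemma subst_id (K : fieldType) n (f : {mpoly K[n]}) :
  subst (fun i => 'X_i) f = f.
Proof. exact: comp_mpoly_id. Qed.

Section Homogeneous.
Variables (K : fieldType) (n : nat).
Implicit Types p q : {mpoly K[n]}.

Lemma mmap1_scale (S : comNzRingType) (c : S) (h : 'I_n -> S) m :
  mmap1 (fun i => c * h i) m = c ^+ mdeg m * mmap1 h m.
Proof.
rewrite /mmap1 mdegE -prodrXr -big_split /=.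
by apply: eq_bigr => i _; rewrite exprMn.
Qed.

Lemma mmap_scale (S : comNzRingType) (f : K -> S) (c : S) (h : 'I_n -> S) d p :
  p \is d.-homog -> mmap f (fun i => c * h i) p = c ^+ d * mmap f h p.
Proof.
move=> /dhomogP hp; rewrite /mmap mulr_sumr !big_seq; apply: eq_bigr => m mp.
by rewrite mmap1_scale (hp _ mp) mulrCA.
Qed.

Lemma meval_scale d p (c : K) v : p \is d.-homog ->
  p.@[fun i => c * v i] = c ^+ d * p.@[v].
Proof. exact: mmap_scale. Qed.

Lemma subst_scale k d p (s : 'I_n -> {mpoly K[k]}) g : p \is d.-homog ->
  subst (fun i => g * s i) p = g ^+ d * subst s p.
Proof.
move=> hp; rewrite /subst /comp_mpoly -(mmap_scale _ _ _ hp).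
apply: eq_bigr => m _; congr (_ * _); apply: mmap1_eq => i.
by rewrite !tnth_mktuple.
Qed.

Lemma map_mpoly_homog (L : fieldType) (e : {rmorphism K -> L}) d p :
  p \is d.-homog -> map_mpoly e p \is d.-homog.
Proof.
move=> hp; apply/dhomogP => m; rewrite mcoeff_msupp mcoeff_map_mpoly => nz.
apply: (dhomogP _ _ _ hp); rewrite mcoeff_msupp.
by apply: contraNneq nz => ->; apply/eqP; exact: raddf0.
Qed.

Lemma homog0_const p : p \is 0.-homog -> p = (p@_0)%:MP.
Proof.
move=> /dhomogP hp; apply: msize1_polyC; rewrite msizeE.
by apply/bigmax_leqP_seq => m mp _; rewrite hp.
Qed.

Lemma homog_meval0 d p : (0 < d)%N -> p \is d.-homog -> p.@[fun=> 0] = 0.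
Proof.
move=> d0 hp.
rewrite (meval_eq p (v2 := fun i => 0 * (fun=> 0) i)) => [|i]; last first.
  by rewrite mul0r.
by rewrite (meval_scale 0 _ hp) expr0n (gtn_eqF d0) mul0r.
Qed.

(** The substitution [t_i := X t_i]; the coefficient of [X^d] in the result is
    the homogeneous component of degree [d]. As it is a ring morphism to
    polynomials over a domain, it reduces questions on homogeneous products to
    divisors of a monomial. *)
Definition grading : {mpoly K[n]} -> {poly {mpoly K[n]}} :=
  mmap (polyC \o @mpolyC n K) (fun i => 'X * ('X_i)%:P).

HB.instance Definition _ := GRing.RMorphism.on grading.

Lemma coef_grading p d : (grading p)`_d = pihomog mdeg d p.
Proof.
have mX m : mmap1 (fun i => ('X_i)%:P : {poly {mpoly K[n]}}) m = ('X_[m])%:P.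
  rewrite mpolyXE_id rmorph_prod; apply: eq_bigr => i _.
  by rewrite rmorphXn.
rewrite /grading /mmap coef_sum pihomogE [RHS]big_mkcond /=.
apply: eq_bigr => m _; rewrite mmap1_scale mX coefCM coefXnM.
case: ltngtP => [lt_md|gt_md|->]; rewrite ?coefC ?subnn ?mulr0 ?mul_mpolyC //.
by rewrite subn_eq0 leqNgt gt_md scaler0.
Qed.

Lemma grading_homog d p : p \is d.-homog -> grading p = 'X^d * p%:P.
Proof.
move=> hp; apply/polyP => i; rewrite coef_grading coefXnM coefC.
case: (eqVneq d i) => [<-|ne]; first by rewrite ltnn subnn pihomog_dE.
rewrite (pihomog_ne0 ne hp); case: ltngtP ne => // lt _.
by rewrite subn_eq0 leqNgt lt.
Qed.

Lemma homog_of_grading d p : grading p = 'X^d * ((grading p)`_d)%:P ->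
  p \is d.-homog.
Proof.
move=> gp; suff -> : p = pihomog mdeg d p by exact: pihomogP.
rewrite [LHS](pihomog_partitionE (mf := @mdeg n) (leqnn (msize p))).
rewrite (eq_bigr (fun i : 'I__ =>
  if i == d :> nat then pihomog mdeg d p else 0)); last first.
  move=> i _; rewrite -!coef_grading {1}gp coefXnM coefC.
  case: ltngtP => // [lt|->]; last by rewrite subnn.
  by rewrite subn_eq0 leqNgt lt.
rewrite -big_mkcond /=; case: (ltnP d (msize p)) => [lt|le].
  by rewrite (big_pred1 (Ordinal lt)).
rewrite big_pred0 => [|i]; last first.
  by apply/eqP => /= ie; have := ltn_ord i; rewrite ie ltnNge le.
symmetry; rewrite pihomogE big_seq_cond big1 // => m /andP[mp /eqP md].
by have := msize_mdeg_lt mp; rewrite md ltnNge le.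
Qed.

(** The image of [p] under [grading] divides a constant times a power of the
    variable, so it is a monomial itself. *)
Lemma homog_factor d p q : p * q \is d.-homog -> p * q != 0 ->
  exists e, p \is e.-homog.
Proof.
move=> hpq nz_pq; have := grading_homog hpq; rewrite rmorphM /= => gpq.
have : grading p %| ('X - 0%:P) ^+ d.
  rewrite subr0; apply: (dvdp_trans (y := 'X^d * (p * q)%:P)).
    by rewrite -gpq dvdp_mulIl.
  rewrite mulrC mul_polyC; apply/Pdiv.Idomain.dvdpP.
  by exists (p * q, 1); rewrite //= mul1r.
case/dvdp_exp_XsubCP => e [_]; rewrite subr0.
case/eqpP => -[c1 c2] /= /andP[nz1 nz2] gE; exists e.
apply: homog_of_grading; apply/polyP => i.
have := congr1 (fun f : {poly _} => f`_i) gE.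
rewrite !coefZ coefXn coefXnM coefC subn_eq0.
case: (ltngtP i e) => [_|_|-> //].
  by rewrite mulr0 => /eqP; rewrite mulf_eq0 (negbTE nz1) => /eqP.
by rewrite mulr0 => /eqP; rewrite mulf_eq0 (negbTE nz1) => /eqP.
Qed.

End Homogeneous.

Lemma subst_homog (K : fieldType) n k d e (s : 'I_k -> {mpoly K[n]})
    (p : {mpoly K[k]}) :
  (forall i, s i \is d.-homog) -> p \is e.-homog ->
  subst s p \is (d * e).-homog.
Proof.
move=> hs /dhomogP hp; rewrite /subst comp_mpolyEX big_seq.
apply: rpred_sum => m mp; apply: rpredZ; rewrite comp_mpolyX.
have <- : mdeg m = e := hp _ mp.
rewrite mdegE big_distrr /=.
elim/big_ind2: _ => [|x1 x2 y1 y2 h1 h2|i _]; first exact: dhomog1.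
  exact: dhomogM.
by rewrite tnth_mktuple; apply: dhomogMn.
Qed.

(** Common divisors are removed one after another; each removal lowers the
    degree of the nonzero member [f i0]. *)
Lemma coprime_reduction (K : fieldType) n k (f : 'I_k -> {mpoly K[n]}) i0 :
  f i0 != 0 -> exists g (s : 'I_k -> {mpoly K[n]}),
    (forall i, f i = g * s i) /\ coprime_family s.
Proof.
have [N] := ubnP (msize (f i0)); elim: N f => // N IH f lt_N nz_f.
case: (classic (coprime_family f)) => [cop|ncop].
  by exists 1, f; split=> // i; rewrite mul1r.
have [g [nUg /fin_all_exists [q fE]]] : exists g, g \isn't a GRing.unit /\
    forall i, exists q, f i = q * g.
  apply: NNPP => no_g; apply: ncop => g fg.
  by apply: contraT => nUg; case: no_g; exists g.
have /andP[nz_q nz_g] : (q i0 != 0) && (g != 0).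
  by rewrite -negb_or -mulf_eq0 -fE.
case: (IH q) => // [|h [s [qE cop]]].
  apply: leq_trans (lt_N : (msize (f i0) <= N)%N).
  rewrite fE msizeM //; case: (leqP (msize g) 1) nUg => [|g1 _].
    by move/(mpoly_msize_le1_unit nz_g)->.
  by case: (msize g) g1 => [|[|b]] // _; rewrite !addnS ltnS leq_addr.
by exists (h * g), s; split=> // i; rewrite fE qE mulrAC.
Qed.

(** * The projective Nullstellensatz in the plane *)

Section Ideal.
Variables (R : comNzRingType) (k : nat).
Implicit Types (f : 'I_k -> R) (p q : R).

Definition in_ideal f p : Prop := exists A : 'I_k -> R, p = \sum_i A i * f i.

Lemma in_idealM f p q : in_ideal f p -> in_ideal f (q * p).
Proof.
case=> A ->; exists (fun i => q * A i); rewrite mulr_sumr.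
by apply: eq_bigr => i _; rewrite mulrA.
Qed.

Lemma in_idealD f p q : in_ideal f p -> in_ideal f q -> in_ideal f (p + q).
Proof.
case=> A -> [B ->]; exists (fun i => A i + B i); rewrite -big_split /=.
by apply: eq_bigr => i _; rewrite mulrDl.
Qed.

Lemma in_ideal_sum f (I : eqType) (r : seq I) (F : I -> R) :
  (forall i, i \in r -> in_ideal f (F i)) -> in_ideal f (\sum_(i <- r) F i).
Proof.
move=> IF; rewrite big_seq; elim/big_ind: _ => //; last exact: in_idealD.
by exists (fun=> 0); rewrite big1 // => i _; rewrite mul0r.
Qed.

End Ideal.

(** Here again [g] is a gcd over the fraction field, and [c] the denominator of
    the Bezout coefficients. *)
Lemma gcd_family (R : idomainType) k (f : 'I_k -> {poly R}) :
  exists (g : {poly R}) (c : R),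
    [/\ forall i, g %| f i, c != 0 & in_ideal f (c%:P * g)].
Proof.
elim: k f => [|k IH] f.
  exists 0, 1; split; rewrite ?oner_eq0 //; first by case.
  by exists (fun=> 0); rewrite mulr0 big_ord0.
have [g [c [gf nz_c [A cgE]]]] := IH (fun i => f (lift ord0 i)).
have [[u v] /= /eqpP[[c1 c2] /= /andP[nz1 nz2] uvE]] := Bezoutp (f ord0) g.
exists (gcdp (f ord0) g), (c * c2); split; last 1 first.
- exists (fun i => if unlift ord0 i is Some j then c1%:P * v * A j
                   else c%:P * c1%:P * u).
  rewrite big_ord_recl unlift_none polyCM -mulrA [c2%:P * _]mul_polyC -uvE.
  rewrite -mul_polyC !mulrDr; congr (_ + _); first by rewrite !mulrA.
  rewrite (eq_bigr (fun i => c1%:P * v * (A i * f (lift ord0 i)))) => [|i _].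
    by rewrite -mulr_sumr -cgE [RHS]mulrCA -!mulrA.
  by rewrite liftK mulrA.
- move=> i; case: (unliftP ord0 i) => [j|] ->; last exact: dvdp_gcdl.
  exact: dvdp_trans (dvdp_gcdr _ _) (gf j).
by rewrite mulf_neq0.
Qed.

Section Nullstellensatz.
Variable K : closedFieldType.

Lemma univariate_nullstellensatz k (f : 'I_k -> {poly K}) :
  (forall b, exists i, (f i).[b] != 0) -> in_ideal f 1.
Proof.
move=> nozero; have [g [c [gf nz_c Icg]]] := gcd_family f.
case: (eqVneq (size g) 1%N) => [/eqP/size_poly1P[d nz_d gE]|].
  have -> : 1 = (c * d)^-1%:P * (c%:P * g).
    by rewrite gE -!polyCM mulVf ?mulf_neq0.
  exact: in_idealM.
move/closed_rootP => [b gb]; have [i /negP[]] := nozero b.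
by have /dvdpP[r ->] := gf i; rewrite hornerM (rootP gb) mulr0.
Qed.

Lemma horner_eval_map (p : {poly {poly K}}) a b :
  p.[b%:P].[a] = (map_poly (horner_eval a) p).[b].
Proof.
rewrite -[in RHS](hornerC b a); symmetry.
exact: (horner_map (horner_eval a) p b%:P).
Qed.

(** Unless the gcd [g] of the family over the fraction field is a nonzero
    constant, it has a zero above a suitable [a], common to the whole family. *)
Lemma elimination_ideal k (f : 'I_k -> {poly {poly K}}) :
  (forall a b, exists i, (f i).[b%:P].[a] != 0) ->
  exists2 c : {poly K}, c != 0 & in_ideal f c%:P.
Proof.
move=> nozero; have [g [c [gf nz_c Icg]]] := gcd_family f.
case: (eqVneq (size g) 1%N) => [/eqP/size_poly1P[d nz_d gE]|sg].
  by exists (c * d); rewrite ?mulf_neq0 // polyCM -gE.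
have /fin_all_exists [m mP] i : exists m : {poly K} * {poly {poly K}},
    m.1 != 0 /\ m.1 *: f i = m.2 * g.
  by have /Pdiv.Idomain.dvdpP [m nz_m mE] := gf i; exists m.
have nz_g : g != 0.
  apply: contraTneq isT => g0; have [i] := nozero 0 0.
  have [nz_m /eqP] := mP i.
  rewrite g0 mulr0 scale_poly_eq0 (negbTE nz_m) => /eqP ->.
  by rewrite !horner0 eqxx.
have [a] : exists a, ~~ root ((\prod_i (m i).1) * lead_coef g) a.
  apply/closed_nonrootP; rewrite mulf_neq0 ?lead_coef_eq0 //.
  by apply/prodf_neq0 => i _; case: (mP i).
rewrite rootM negb_or => /andP[ma la].
have sga : size (map_poly (horner_eval a) g) != 1%N.
  by rewrite size_map_poly_id0.
have /closed_rootP[b gb] := sga; have [i] := nozero a b.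
rewrite horner_eval_map.
case: (mP i) => nz_m /(congr1 (map_poly (horner_eval a))).
rewrite map_polyZ rmorphM /= => /(congr1 (horner^~ b)).
rewrite hornerZ hornerM (rootP gb) mulr0 => /eqP.
rewrite mulf_eq0 => /orP[/eqP mi0|->] //; case/negP: ma.
by rewrite /root horner_prod (bigD1 i) //= -[_.[a]]/(horner_eval a _) mi0 mul0r.
Qed.

Lemma divides_XsubC_of_eval (p : {poly {poly K}}) a :
  map_poly (horner_eval a) p = 0 -> divides ('X - a%:P)%:P p.
Proof.
move=> pa; apply/dividesCP => i.
have /factor_theorem [q ->] : root p`_i a; last by exists q.
by apply/rootP; rewrite -[_.[a]]/(horner_eval a _) -coef_map pa coef0.
Qed.

(** The univariate case solves the problem on the line where the first
    coordinate is [a]; the error of that solution is a multiple of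
    ['X - a], which the hypothesis absorbs. *)
Lemma in_ideal_cancel_root k (f : 'I_k -> {poly {poly K}}) c a :
  (forall a b, exists i, (f i).[b%:P].[a] != 0) ->
  in_ideal f (c * ('X - a%:P))%:P -> in_ideal f c%:P.
Proof.
move=> nozero Ica.
have [B BE] : in_ideal (fun i => map_poly (horner_eval a) (f i)) 1.
  apply: univariate_nullstellensatz => b; have [i fi] := nozero a b.
  by exists i; rewrite -horner_eval_map.
have IB : in_ideal f (\sum_i map_poly polyC (B i) * f i).
  by exists (fun i => map_poly polyC (B i)).
have [|D DE] :=
  @divides_XsubC_of_eval (\sum_i map_poly polyC (B i) * f i - 1) a.
  rewrite rmorphB rmorph1 rmorph_sum BE /=; apply/eqP.
  rewrite subr_eq0; apply/eqP.
  apply: eq_bigr => i _; rewrite rmorphM /= -map_poly_comp /=; congr (_ * _).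
  rewrite (eq_map_poly (g := idfun)) ?map_poly_id // => x /=.
  by rewrite /horner_eval hornerC.
have -> : c%:P = c%:P * (\sum_i map_poly polyC (B i) * f i)
    + (- D) * (c * ('X - a%:P))%:P.
  by rewrite polyCM mulNr mulrCA -DE mulrBr mulr1 opprB addrC subrK.
by apply: in_idealD; apply: in_idealM.
Qed.

(** The element given by [elimination_ideal] is a product of linear factors,
    which [in_ideal_cancel_root] removes one by one. *)
Theorem bivariate_nullstellensatz k (f : 'I_k -> {poly {poly K}}) :
  (forall a b, exists i, (f i).[b%:P].[a] != 0) -> in_ideal f 1.
Proof.
move=> nozero; have [c nz_c Ic] := elimination_ideal nozero.
have [r cE] := closed_field_poly_normal c.
have nz_lc : lead_coef c != 0 by rewrite lead_coef_eq0.
have : in_ideal f (lead_coef c)%:P%:P.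
  rewrite cE -mul_polyC in Ic; elim: r {cE} Ic => [|z r IH].
    by rewrite big_nil mulr1.
  by rewrite big_cons mulrCA mulrC => /(in_ideal_cancel_root nozero)/IH.
move/(in_idealM (lead_coef c)^-1%:P%:P).
by rewrite -!polyCM mulVf.
Qed.

End Nullstellensatz.

Section ProjectiveNullstellensatz.
Variables (K : closedFieldType) (k q : nat) (Q : 'I_k -> {mpoly K[3]}).
Hypothesis Q_homog : forall j, Q j \is q.-homog.

Lemma pihomog_mul n d e (p f : {mpoly K[n]}) : f \is e.-homog ->
  pihomog mdeg d (p * f) =
  (if (e <= d)%N then pihomog mdeg (d - e) p else 0) * f.
Proof.
move=> hf; rewrite -coef_grading rmorphM /= (grading_homog hf) mulrA coefMC.
rewrite mulrC coefMXn ltnNge; case: leqP => //= _; rewrite ?mulr0 ?mul0r //.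
by rewrite coef_grading mulrC.
Qed.

Lemma in_ideal_pihomog d p : in_ideal Q p -> in_ideal Q (pihomog mdeg d p).
Proof.
case=> A ->; rewrite linear_sum /=; apply: in_ideal_sum => j _.
rewrite (pihomog_mul _ _ (Q_homog j)); apply: in_idealM.
exists (fun i => (i == j)%:R); rewrite (bigD1 j) //= eqxx mul1r big1 ?addr0 //.
by move=> i /negbTE ->; rewrite mul0r.
Qed.

Hypothesis Q_nozero : forall v, nonzero_vec v -> nonzero_vec (eval_forms Q v).

Definition chart_point (S : nzRingType) (i : 'I_3) (a b : S) : 'I_3 -> S :=
  fun l => if unlift i l is Some j then (if j == ord0 then a else b) else 1.

Lemma chart_point_scale (i : 'I_3) (v : 'I_3 -> K) : v i != 0 ->
  forall l, v l = v i * chart_point i (v (lift i ord0) / v i)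
                                      (v (lift i ord_max) / v i) l.
Proof.
move=> nz l; rewrite /chart_point.
case: (unliftP i l) => [j|] ->; last by rewrite mulr1.
case: eqP => [->|/eqP nj]; first by rewrite mulrCA divff ?mulr1.
have -> : j = ord_max by case: j nj => -[|[|//]] // lt nj; apply/val_inj.
by rewrite mulrCA divff ?mulr1.
Qed.

(** In the affine chart where the coordinate [i] equals [1] there is a
    combination of the [Q j] equal to [1]. Multiplying each of its homogeneous
    components by the right power of ['X_i] gives a form in the ideal that
    agrees with a power of ['X_i] on the chart, hence everywhere. *)
Lemma projective_nullstellensatz (i : 'I_3) :
  exists N, in_ideal Q ('X_i ^+ N).
Proof.
pose phi : {mpoly K[3]} -> {poly {poly K}} :=
  mmap (polyC \o polyC) (chart_point i ('X)%:P 'X).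
have phiE p a b : (phi p).[b%:P].[a] = p.@[chart_point i a b].
  apply: (mpoly_rmorph_eq
    (f := horner_eval a \o horner_eval b%:P \o mmap (polyC \o polyC) _)) p.
    by move=> c /=; rewrite mmapC /= /horner_eval !hornerC mevalC.
  move=> l; rewrite /= mmapX mmap1U mevalXU /chart_point /horner_eval.
  by case: (unlift i l) => [j|]; [case: eqP|]; rewrite ?(hornerC, hornerX).
have [|A AE] := @bivariate_nullstellensatz K k (fun j => phi (Q j)).
  move=> a b; have [|j Qj] := Q_nozero (v := chart_point i a b).
    by exists i; rewrite /chart_point unlift_none oner_eq0.
  by exists j; rewrite phiE.
pose psi (p : {poly {poly K}}) : {mpoly K[3]} :=
  (map_poly (horner_eval 'X_(lift i ord0) \o map_poly (@mpolyC 3 K)) p)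
    .['X_(lift i ord_max)].
have psiE p a b : (psi p).@[chart_point i a b] = p.[b%:P].[a].
  have pt0 : chart_point i a b (lift i ord0) = a by rewrite /chart_point liftK.
  have pt1 : chart_point i a b (lift i ord_max) = b.
    by rewrite /chart_point liftK.
  rewrite /psi -horner_map /= mevalXU -map_poly_comp horner_eval_map pt1.
  congr _.[_]; apply: eq_map_poly => r /=.
  rewrite /horner_eval -horner_map /= mevalXU -map_poly_comp pt0.
  rewrite (eq_map_poly (g := idfun)) ?map_poly_id // => x /=.
  by rewrite mevalC.
pose B := \sum_j psi (A j) * Q j.
have B1 a b : B.@[chart_point i a b] = 1.
  rewrite /B rmorph_sum /=; have := congr1 (fun p => p.[b%:P].[a]) AE.
  rewrite /= !hornerC => ->; rewrite horner_sum horner_sum.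
  apply: eq_bigr => j _.
  by rewrite rmorphM /= psiE !hornerM phiE.
(* One factor ['X_i] beyond those needed to make the degrees equal: with it both
   sides vanish off the chart. *)
pose M := msize B; exists M.+1.
suff -> : 'X_i ^+ M.+1 =
    \sum_(d < M) ('X_i * 'X_i ^+ (M - d)) * pihomog mdeg d B.
  apply: in_ideal_sum => d _; apply: in_idealM; apply: in_ideal_pihomog.
  by exists (fun j => psi (A j)).
apply: mpoly_eq_points => v; rewrite rmorph_sum /= rmorphXn /= mevalXU.
rewrite (eq_bigr (fun d : 'I_M => v i * (v i ^+ (M - d) *
  (pihomog mdeg d B).@[v]))) => [|d _]; last first.
  by rewrite !rmorphM rmorphXn /= mevalXU mulrA.
rewrite -mulr_sumr exprS.
case: (eqVneq (v i) 0) => [->|nz]; first by rewrite !mul0r.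
congr (_ * _).
pose a := v (lift i ord0) / v i; pose b := v (lift i ord_max) / v i.
transitivity (v i ^+ M * \sum_(d < M) (pihomog mdeg d B).@[chart_point i a b]).
  by rewrite -rmorph_sum -(pihomog_partitionE (leqnn _)) /= B1 mulr1.
rewrite mulr_sumr; apply: eq_bigr => d _.
rewrite (meval_eq _ (chart_point_scale nz)) (meval_scale _ _ (pihomogP _ _ _)).
by rewrite mulrA -exprD subnK // ltnW.
Qed.

(** A monomial of large degree is divisible by a large power of some variable.
    The components of the right degree of any coefficients are homogeneous
    coefficients. *)
Lemma high_degree_in_ideal :
  exists N, forall d p, (N <= d)%N -> p \is d.-homog ->
    exists A : 'I_k -> {mpoly K[3]},
      (forall j, A j \is (d - q).-homog) /\ p = \sum_j A j * Q j.
Proof.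
have /fin_all_exists [N NP] i := projective_nullstellensatz i.
exists (maxn q (\sum_i N i).+1) => d p le_Nd hp.
have [A AE] : in_ideal Q p.
  rewrite (mpolyE p); apply: in_ideal_sum => m mp.
  have md : mdeg m = d := dhomogP _ _ _ hp _ mp.
  have [i le_i] : exists i, (N i <= m i)%N.
    apply: NNPP => no; have : (mdeg m <= \sum_i N i)%N.
      rewrite mdegE; apply: leq_sum => i _; rewrite leqNgt; apply/negP => lt.
      by apply: no; exists i; apply: ltnW.
    by rewrite md leqNgt (leq_trans _ le_Nd) ?leq_maxr.
  rewrite -mul_mpolyC; apply: in_idealM.
  have -> : m = ((m - U_(i) *+ N i) + U_(i) *+ N i)%MM.
    rewrite submK //; apply/mnm_lepP => j; rewrite mulmnE mnm1E.
    by case: eqP => [<-|]; rewrite ?mul1n ?mul0n.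
  by rewrite mpolyXD -mpolyXn; apply: in_idealM.
exists (fun j => pihomog mdeg (d - q) (A j)); split=> [j|].
  exact: pihomogP.
rewrite -[LHS](pihomog_dE hp) AE linear_sum /=; apply: eq_bigr => j _.
by rewrite (pihomog_mul _ _ (Q_homog j)) (leq_trans _ le_Nd) ?leq_maxl.
Qed.

End ProjectiveNullstellensatz.

(** * Hilbert functions and the degree of the image *)

Section LinearMapsOfForms.
Variable K : fieldType.

Lemma mul_form_homog k u v w (p : {mpoly K[k]}) (f : dhomog k K v) :
  p \is u.-homog -> w = (u + v)%N -> p * val f \is w.-homog.
Proof. by move=> hp ->; apply: dhomogM => //; apply: dhomog_is_dhomog. Qed.

Definition mul_form k u v w (p : {mpoly K[k]}) (hp : p \is u.-homog)
    (ce : w = (u + v)%N) (f : dhomog k K v) : dhomog k K w :=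
  DHomog (mul_form_homog f hp ce).

Fact mul_form_is_linear k u v w p hp ce : linear (@mul_form k u v w p hp ce).
Proof.
move=> x f g; apply/val_inj => /=.
by rewrite mulrDr scalerAr.
Qed.

HB.instance Definition _ k u v w p hp ce :=
  GRing.isLinear.Build K (dhomog k K v) (dhomog k K w) _
    (@mul_form k u v w p hp ce) (@mul_form_is_linear k u v w p hp ce).

Definition subst_form k l q n (s : 'I_l -> {mpoly K[k]})
    (hs : forall i, s i \is q.-homog) (f : dhomog l K n) : dhomog k K (q * n) :=
  DHomog (subst_homog hs (dhomog_is_dhomog f)).

Fact subst_form_is_linear k l q n s hs : linear (@subst_form k l q n s hs).
Proof.
move=> x f g; apply/val_inj => /=.
by rewrite raddfD /= substZ.
Qed.

HB.instance Definition _ k l q n s hs :=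
  GRing.isLinear.Build K (dhomog l K n) (dhomog k K (q * n)) _
    (@subst_form k l q n s hs) (@subst_form_is_linear k l q n s hs).

Lemma dim_forms k n : \dim {:dhomog k.+1 K n} = 'C(n + k, n).
Proof. by rewrite dimvf. Qed.

Lemma mul_form_inj k u v w (p : {mpoly K[k.+1]}) (hp : p \is u.-homog)
    (ce : w = (u + v)%N) :
  p != 0 -> \dim (limg (linfun (mul_form hp ce))) = 'C(v + k, v).
Proof.
move=> nz_p; rewrite -dim_forms limg_dim_eq //.
apply/eqP; rewrite capfv; apply/lker0P => f g; rewrite !lfunE => fg.
by apply/val_inj/(mulfI nz_p)/(congr1 val fg).
Qed.

End LinearMapsOfForms.

Lemma binomial2 n : (2 * 'C(n + 2, n) = (n + 1) * (n + 2))%N.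
Proof.
rewrite -[X in 'C(_, X)](addnK 2 n) bin_sub ?leq_addl // mulnC.
by have := bin_ffact (n + 2) 2; rewrite !ffactnS ffactn0 !factS fact0; lia.
Qed.

Lemma binomial3 n : (6 * 'C(n + 3, n) = (n + 1) * (n + 2) * (n + 3))%N.
Proof.
rewrite -[X in 'C(_, X)](addnK 3 n) bin_sub ?leq_addl // mulnC.
have := bin_ffact (n + 3) 3; rewrite !ffactnS ffactn0 !factS fact0.
rewrite (_ : (3 * (2 * (1 * 1)) = 6)%N) // => ->.
by rewrite !addnS !addn0 /= !muln1; nia.
Qed.

Lemma quadratic_growth a b S T :
  (forall n, a * n ^ 2 <= b * n ^ 2 + S * n + T)%N -> (a <= b)%N.
Proof.
move=> H; rewrite leqNgt; apply/negP => lt_ba.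
have := H (S + T + 1)%N; set n := (S + T + 1)%N.
have : (b.+1 * n ^ 2 <= a * n ^ 2)%N by rewrite leq_mul2r lt_ba orbT.
by rewrite mulSn !expnS expn0 muln1 {}/n; nia.
Qed.

Section DegreeOfImage.
Variables (K : closedFieldType) (q d e : nat).
Variables (Q : 'I_4 -> {mpoly K[3]}) (F : {mpoly K[4]}).
Hypotheses (Q_homog : forall j, Q j \is q.-homog) (F_homog : F \is d.-homog).
Hypotheses (F_neq0 : F != 0) (d_gt0 : (0 < d)%N).
Hypothesis QF : subst Q F = 0.
Hypothesis Q_ker : forall n G, G \is n.-homog -> subst Q G = 0 -> divides F G.

Let rk n := \dim (limg (linfun (@subst_form K 3 4 q n Q Q_homog))).

Lemma rk_le n : (rk n <= 'C(q * n + 2, q * n))%N.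
Proof. by rewrite -(dim_forms K 2); apply/dimvS/subvf. Qed.

(** The rank theorem: the kernel of the substitution consists of the multiples
    of [F], so its dimension is that of the space of cofactors, which are forms
    of degree [n]. *)
Lemma rk_hypersurface n : (rk (d + n) + 'C(n + 3, n) = 'C(d + n + 3, d + n))%N.
Proof.
rewrite -[RHS](etrans (limg_ker_dim
  (linfun (@subst_form K 3 4 q (d + n) Q Q_homog)) fullv) (dim_forms K 3 _)).
rewrite addnC.
congr (_ + _)%N; rewrite -(mul_form_inj F_homog (erefl (d + n)%N) F_neq0).
congr (\dim _); apply/eqP; rewrite eqEsubv; apply/andP; split.
  apply/subvP => f /memv_imgP[g _ ->].
  rewrite memv_cap memvf memv_ker !lfunE /=.
  by apply/eqP/val_inj; rewrite /= rmorphM /= QF mul0r.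
apply/subvP => f; rewrite memv_cap memvf memv_ker lfunE /=.
move/eqP/(congr1 val) => /=; move/(Q_ker (dhomog_is_dhomog f)) => [g fE].
have [f0|nz_f] := eqVneq (val f) 0.
  by rewrite (_ : f = 0) ?mem0v //; apply/val_inj.
have [m hg] : exists m, g \is m.-homog.
  by apply: (@homog_factor _ _ (d + n) g F); rewrite -fE ?dhomog_is_dhomog.
have mn : m = n.
  have := dhomog_uniq nz_f (dhomog_is_dhomog f).
  move/(_ (m + d)%N); rewrite fE => /(_ (dhomogM hg F_homog)).
  by rewrite addnC => /addIn ->.
rewrite mn in hg.
have -> : f = linfun (mul_form F_homog (erefl (d + n)%N)) (DHomog hg).
  by rewrite lfunE; apply/val_inj; rewrite /= fE mulrC.
exact/memv_img/memvf.
Qed.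

Lemma degree_le_square : (d <= q ^ 2)%N.
Proof.
suff : (3 * d <= 3 * q ^ 2)%N by rewrite leq_mul2l.
(* The constants are the lower coefficients, as polynomials in [n], of six times
   the bound on [rk (d + n)]. *)
apply: (@quadratic_growth _ _ (6 * q ^ 2 * d + 9 * q)
  (3 * q ^ 2 * d ^ 2 + 9 * q * d + 6)) => n.
have := rk_le (d + n); have := rk_hypersurface n.
have := binomial2 (q * (d + n)); have := binomial3 (d + n); have := binomial3 n.
move: 'C(_, _) 'C(_, _) 'C(_, _) (rk _) => x y z t.
by rewrite !expnS !expn0 !muln1; nia.
Qed.

Hypothesis Q_nozero : forall v, nonzero_vec v -> nonzero_vec (eval_forms Q v).
Variables (r : 'I_3 -> {mpoly K[4]}) (h : {mpoly K[3]}).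
Hypotheses (r_homog : forall i, r i \is e.-homog) (h_neq0 : h != 0).
Hypothesis Qr : forall i, subst Q (r i) = h * 'X_i.

Lemma inverse_factor_homog : exists2 u, h \is u.-homog & (u.+1 = q * e)%N.
Proof.
have hX : h * 'X_ord0 \is (q * e).-homog by rewrite -Qr; apply: subst_homog.
have nz : h * 'X_ord0 != 0 by rewrite mulf_neq0 ?mpolyU_neq0.
have [u hu] := homog_factor hX nz; exists u => //.
apply: (dhomog_uniq nz _ hX); rewrite -[u.+1]addn1; apply: dhomogM => //.
by rewrite dhomogX; apply/eqP/mdeg1.
Qed.

(** For a form [f] of degree [q * N], the product of [f] by the corresponding
    power of [h] is [f] evaluated at [h t_i = r_i(Q)]. A form of larger degree
    is a combination of the [Q j] with coefficients of degree smaller by [q],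
    to which the induction applies. The same power of [h] serves for all
    degrees, so it costs only a constant shift of the degree. *)
Lemma conductor : (0 < q)%N ->
  exists N, forall t f, f \is (q * (N + t)).-homog ->
    exists2 G, G \is (t + e * (q * N)).-homog & h ^+ (q * N) * f = subst Q G.
Proof.
move=> q_gt0; have [N NP] := high_degree_in_ideal Q_homog Q_nozero.
exists N; elim=> [|t IH] f hf.
  exists (subst r f); first by rewrite addn0 in hf *; apply: subst_homog.
  rewrite subst_subst (eq_subst (r := fun i => h * 'X_i)) //.
  by rewrite addn0 in hf; rewrite (subst_scale _ _ hf) subst_id.
have [|A [hA ->]] := NP _ _ _ hf.
  by rewrite (leq_trans (leq_addr t.+1 N)) // leq_pmull.
have /fin_all_exists2 [G hG GE] j : exists2 G,
    G \is (t + e * (q * N)).-homog & h ^+ (q * N) * A j = subst Q G.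
  by apply: IH; have := hA j; rewrite addnS mulnS addKn.
exists (\sum_j G j * 'X_j).
  apply: rpred_sum => j _; rewrite addSn -[(_ + _).+1%N]addn1.
  apply: dhomogM => //.
  by rewrite dhomogX; apply/eqP/mdeg1.
rewrite rmorph_sum mulr_sumr; apply: eq_bigr => j _.
by rewrite rmorphM /= substX -GE mulrA.
Qed.

Lemma rk_ge : (0 < q)%N ->
  exists N c, forall t, ('C(q * (N + t) + 2, q * (N + t)) <= rk (t + c))%N.
Proof.
move=> q_gt0; have [N NP] := conductor q_gt0; exists N, (e * (q * N))%N => t.
have [u hu ue] := inverse_factor_homog.
have hH : h ^+ (q * N) \is (u * (q * N)).-homog by apply: dhomogMn.
have de : (q * (t + e * (q * N)) = u * (q * N) + q * (N + t))%N.
  rewrite mulnDr mulnA -ue mulSn mulnDr; lia.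
rewrite -(mul_form_inj hH de) ?expf_neq0 //; apply: dimvS.
apply/subvP => f /memv_imgP[g _ ->]; rewrite lfunE /=.
have [G hG GE] := NP t _ (dhomog_is_dhomog g).
rewrite (_ : mul_form hH de g =
    linfun (@subst_form K 3 4 q _ Q Q_homog) (DHomog hG)).
  exact/memv_img/memvf.
by rewrite lfunE; apply/val_inj.
Qed.

Theorem degree_eq_square : d = (q ^ 2)%N.
Proof.
apply/eqP; rewrite eqn_leq degree_le_square /=.
have q_gt0 : (0 < q)%N.
  by case: (posnP q) (leq_trans d_gt0 degree_le_square) => // ->.
have [N [c H]] := rk_ge q_gt0.
suff : (3 * q ^ 2 <= 3 * d)%N by rewrite leq_mul2l.
(* The constants are the lower coefficients, as polynomials in [n], of
   [6 * rk (d + n + c)]. *)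
apply: (@quadratic_growth _ _ (6 * d * c + 3 * d ^ 2 + 12 * d)
  (3 * d * c ^ 2 + (3 * d ^ 2 + 12 * d) * c + d ^ 3 + 6 * d ^ 2 + 11 * d)) => n.
have := H (d + n)%N; rewrite -addnA; set w := (n + c)%N => le_rk.
have eq_rk := rk_hypersurface w.
have le_qn :
  ((q * n) ^ 2 <= (q * (N + (d + n)) + 1) * (q * (N + (d + n)) + 2))%N.
  have : (q * n <= q * (N + (d + n)))%N.
    by rewrite leq_mul2l; apply/orP; right; lia.
  by move: (q * n)%N (q * _)%N => x y; nia.
rewrite -binomial2 in le_qn.
have rkE : (6 * rk (d + w) =
    3 * d * w ^ 2 + (3 * d ^ 2 + 12 * d) * w + (d ^ 3 + 6 * d ^ 2 + 11 * d))%N.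
  move: eq_rk (binomial3 (d + w)) (binomial3 w).
  move: 'C(_, _) 'C(_, _) (rk _) => x y z.
  by rewrite !expnS !expn0 !muln1; nia.
have : (3 * (q * n) ^ 2 <= 6 * rk (d + w))%N.
  rewrite (_ : 6 = 3 * 2)%N // -mulnA leq_mul2l /=.
  by apply: leq_trans le_qn _; rewrite leq_mul2l.
by rewrite rkE /w !expnS !expn0 !muln1; nia.
Qed.

End DegreeOfImage.

(** * Parametrizations of a surface *)

Section Surfaces.
Variables (K : closedFieldType) (X : surface K).

Lemma coprime_family_neq0 n k (m : 'I_k -> {mpoly K[n]}) :
  coprime_family m -> exists i, m i != 0.
Proof.
move=> cop; apply: NNPP => all0; have : (0 : {mpoly K[n]}) \is a GRing.unit.
  apply: cop => i; exists 0; rewrite mulr0; apply/eqP; apply: contraT => nz.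
  by case: all0; exists i.
by rewrite unitr0.
Qed.

(** Multiplied by a variable and by a nonzero component of [M], the polynomial
    vanishes at every point. *)
Lemma vanishing_on_domain k (M : ratmap K k) p :
  (forall t, defined_at M t -> p.@[t] = 0) -> p = 0.
Proof.
move=> p0; have [i nz_i] := coprime_family_neq0 (ratmap_coprime (r := M)).
have nz : 'X_ord0 * M i != 0 by rewrite mulf_neq0 // mpolyU_neq0.
apply: (mulfI nz); rewrite mulr0; apply: mpoly_eq_points => t.
rewrite mevalM meval0; case: (eqVneq ('X_ord0 * M i).@[t] 0) => [->|].
  by rewrite mul0r.
rewrite mevalM mulf_eq0 negb_or mevalXU => /andP[t0 Mt].
by rewrite p0 ?mulr0 //; split; [exists ord0 | exists i].
Qed.

Lemma surface_form_neq0 : surface_form X != 0.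
Proof. by case: (surface_irr X). Qed.

Lemma surface_form_prime : prime_element (surface_form X).
Proof.
case: (surface_irr X) => nz nU irr.
exact: irreducible_prime (@factorial_mpoly K 4) _ nz nU irr.
Qed.

Lemma surface_deg_gt0 : (0 < surface_deg X)%N.
Proof.
rewrite lt0n; apply/negP => /eqP d0; have hF := surface_homog X.
rewrite d0 in hF; case: (surface_irr X) => nz /negP[].
rewrite (homog0_const hF) mpoly_field_unit //.
by apply: contraNneq nz => c0; rewrite (homog0_const hF) c0 mpolyC0.
Qed.

Lemma surface_form_pullback (M : ratmap K 3) :
  dominant_onto M X -> subst M (surface_form X) = 0.
Proof.
case=> MX _; apply: (@vanishing_on_domain _ M) => t /MX[_].
by rewrite meval_subst.
Qed.

(** By dominance [G] vanishes on [X], where the Nullstellensatz applies. The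
    origin, which is not a point of [X], forces the case of constant [G]
    apart. *)
Lemma dominant_kernel (M : ratmap K 3) n G : dominant_onto M X ->
  G \is n.-homog -> subst M G = 0 -> divides (surface_form X) G.
Proof.
move=> [MX domM] hG MG; case: (posnP n) => [n0|n_gt0].
  exists 0; rewrite mul0r; move: MG; rewrite n0 in hG.
  by rewrite (homog0_const hG) substC => /eqP; rewrite mpolyC_eq0 => /eqP ->.
apply: prime_nullstellensatz surface_form_prime _ => x Fx.
case: (classic (nonzero_vec x)) => [nz_x|z_x].
  apply: (domM n G hG) => [t Mt|]; last by split.
  by have := congr1 (meval t) MG; rewrite meval_subst meval0.
rewrite (meval_eq (v2 := fun=> 0)) ?(homog_meval0 n_gt0 hG) // => i.
by apply/eqP; apply: contraT => xi; case: z_x; exists i.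
Qed.

Lemma coprime_variables (g : {mpoly K[3]}) :
  (forall i, divides g 'X_i) -> g \is a GRing.unit.
Proof.
move=> gX; have [c cE] := gX ord0; have [b bE] := gX ord_max.
have /andP[nz_c nz_g] : (c != 0) && (g != 0).
  by rewrite -negb_or -mulf_eq0 -cE mpolyU_neq0.
apply: mpoly_msize_le1_unit => //; rewrite leqNgt; apply/negP => g_gt1.
have s2 : (msize c + msize g).-1 = 2%N by rewrite -msizeM // -cE msizeX mdeg1.
have /msize1_polyC c_const : (msize c <= 1)%N.
  by move: s2 g_gt1; case: (msize c) (msize g) => [|[|x]] [|[|y]] //=; lia.
pose v (i : 'I_3) : K := (i == ord_max)%:R.
have c0 : c@_0 != 0 by apply: contraNneq nz_c => c0; rewrite c_const c0.
have := congr1 (meval v) cE; rewrite mevalM c_const mevalC mevalXU /v /=.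
move/esym/eqP; rewrite mulf_eq0 (negbTE c0) /= => /eqP gv.
have := congr1 (meval v) bE; rewrite mevalM gv mulr0 mevalXU /v eqxx => /eqP.
by rewrite oner_eq0.
Qed.

End Surfaces.

Section BirationalParametrization.
Variables (K : closedFieldType) (X : surface K) (Q : ratmap K 3).
Variables (e : nat) (r : 'I_3 -> {mpoly K[4]}).
Hypothesis Q_dominant : dominant_onto Q X.
Hypothesis r_homog : forall i, r i \is e.-homog.
Hypothesis rQ_def : exists2 t, defined_at Q t
  & nonzero_vec (eval_forms r (eval_forms Q t)).
Hypothesis rQ : forall t, defined_at Q t ->
  nonzero_vec (eval_forms r (eval_forms Q t)) ->
  same_point (eval_forms r (eval_forms Q t)) t.

(** The forms [r_i(Q)] are proportional to the variables, which are coprime. *)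
Lemma inverse_pullback :
  exists2 h, h != 0 & forall i, subst Q (r i) = h * 'X_i.
Proof.
have prop i : 'X_ord0 * subst Q (r i) = subst Q (r ord0) * 'X_i.
  apply/eqP; rewrite -subr_eq0; apply/eqP.
  apply: (@vanishing_on_domain _ _ Q) => t Qt.
  rewrite mevalB !mevalM !mevalXU !meval_subst.
  rewrite -[(r i).@[_]]/(eval_forms r (eval_forms Q t) i).
  rewrite -[(r ord0).@[_]]/(eval_forms r (eval_forms Q t) ord0).
  case: (classic (nonzero_vec (eval_forms r (eval_forms Q t)))) => [nz|z].
    by have [c _ E] := rQ Qt nz; rewrite !E mulrA [t ord0 * c]mulrC subrr.
  have rz j : eval_forms r (eval_forms Q t) j = 0.
    by apply/eqP; apply: contraT => nz; case: z; exists j.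
  by rewrite !rz mulr0 mul0r subrr.
have [h hE] := proportional_coprime_divides (@factorial_mpoly K 3)
  (mpolyU_neq0 K ord0) (@coprime_variables K) prop.
have hX i : subst Q (r i) = h * 'X_i.
  apply: (mulfI (mpolyU_neq0 K ord0)).
  by rewrite prop hE mulrCA mulrA.
exists h => //; have [t Qt [i]] := rQ_def; apply: contraNneq => h0.
by rewrite /eval_forms -meval_subst hX h0 mul0r meval0.
Qed.

Lemma surface_deg_square : without_base_points Q ->
  surface_deg X = (ratmap_deg Q ^ 2)%N.
Proof.
move=> Q_nozero; have [h nz_h hE] := inverse_pullback.
exact: (degree_eq_square (ratmap_homog Q) (surface_homog X)
  (surface_form_neq0 X) (surface_deg_gt0 X) (surface_form_pullback Q_dominant)
  (fun n G => @dominant_kernel K X Q n G Q_dominant) Q_nozero r_homog nz_h hE).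
Qed.

End BirationalParametrization.

Lemma coprime_composition (K : closedFieldType) k n (Q : ratmap K k)
    (s : 'I_3 -> {mpoly K[n]}) :
  without_base_points Q -> coprime_family s ->
  coprime_family (fun j => subst s (Q j)).
Proof.
move=> Q_nozero cop g gQ.
have gs i : exists N, divides g (s i ^+ N).
  have [N [A NE]] := projective_nullstellensatz (ratmap_homog Q) Q_nozero i.
  exists N; have := congr1 (subst s) NE; rewrite rmorphXn /= substX => ->.
  rewrite rmorph_sum; elim/big_ind: _ => [|p p' gp gp'|j _].
  - by exists 0; rewrite mul0r.
  - exact: dividesD.
  by rewrite rmorphM; apply: divides_mull; apply: gQ.
have [g0|nz_g] := eqVneq g 0.
  apply: cop => i; have [N [c]] := gs i; rewrite g0 mulr0 => /eqP.
  by rewrite expf_eq0 => /andP[_ /eqP ->]; exists 0; rewrite mulr0.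
have [//|[p pp pg]] := factorable_prime_or_unit (factorial_mpoly nz_g).
case: (pp) => _ /negP[]; apply: cop => i; have [N gN] := gs i.
exact: prime_divides_exp pp (divides_trans pg gN).
Qed.

Lemma homog_cofactor (K : fieldType) n k d (f s : 'I_k -> {mpoly K[n]}) g i0 :
  (forall i, f i \is d.-homog) -> f i0 != 0 -> (forall i, f i = g * s i) ->
  exists u, forall i, s i \is u.-homog.
Proof.
move=> hf nz_f fE.
have [w hg] : exists w, g \is w.-homog.
  by apply: (@homog_factor _ _ d g (s i0)); rewrite -fE.
have deg_s i : f i != 0 -> exists2 u, s i \is u.-homog & (w + u = d)%N.
  move=> nz; have [u hs] : exists u, s i \is u.-homog.
    by apply: (@homog_factor _ _ d (s i) g); rewrite mulrC -fE.
  exists u => //; apply: (dhomog_uniq nz) => //.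
  by rewrite fE; apply: dhomogM.
have [u _ wu] := deg_s _ nz_f; exists u => i.
have [f0|nz] := eqVneq (f i) 0; last first.
  by have [u' hs wu'] := deg_s _ nz; rewrite -(addnI (etrans wu' (esym wu))).
have nz_g : g != 0 by apply: contraNneq nz_f => g0; rewrite fE g0 mul0r.
move/eqP: f0; rewrite fE mulf_eq0 (negbTE nz_g) /= => /eqP ->.
exact: dhomog0.
Qed.

Section Lift.
Variables (K : closedFieldType) (X : surface K) (P Q : ratmap K 3).
Variables (e : nat) (r : 'I_3 -> {mpoly K[4]}).
Hypotheses (P_dominant : dominant_onto P X) (Q_dominant : dominant_onto Q X).
Hypothesis Q_nozero : without_base_points Q.
Hypothesis q_gt0 : (0 < ratmap_deg Q)%N.
Hypothesis r_homog : forall i, r i \is e.-homog.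
Hypothesis rQ_def : exists2 t, defined_at Q t
  & nonzero_vec (eval_forms r (eval_forms Q t)).
Hypothesis Qr : forall x, on_surface X x -> defined_at Q (eval_forms r x) ->
  same_point (eval_forms Q (eval_forms r x)) x.

(** The [r_i(P)] do not all vanish: otherwise, by dominance of [P], the [r_i]
    would vanish on [X], hence on the image of [Q]. *)
Lemma inverse_lift : exists (S : ratmap K 2) g,
  g != 0 /\ forall i, subst P (r i) = g * S i.
Proof.
have [i0 nz_i0] : exists i, subst P (r i) != 0.
  apply: NNPP => all0; have [t Qt [i /eqP[]]] := rQ_def.
  apply: (proj2 P_dominant e (r i) (r_homog i)) => [t' _|].
    rewrite -[eval_forms P t']/(fun j => (P j).@[t']) -meval_subst.
    suff -> : subst P (r i) = 0 by rewrite meval0.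
    by apply/eqP; apply: contraT => nz; case: all0; exists i.
  by case: Q_dominant => QX _; apply: QX.
have [g [s [sE cop]]] := coprime_reduction (f := fun i => subst P (r i)) nz_i0.
have [u hs] := homog_cofactor
  (fun i => subst_homog (ratmap_homog P) (r_homog i)) nz_i0 sE.
exists (Ratmap hs cop), g; split=> //.
by apply: contraNneq nz_i0 => g0; rewrite sE g0 mul0r.
Qed.

Lemma proportional_lift (S : ratmap K 2) g i j : g != 0 ->
  (forall l, subst P (r l) = g * S l) ->
  P i * subst S (Q j) = P j * subst S (Q i).
Proof.
move=> nz_g SE; have gS l : subst (fun l => subst P (r l)) (Q l) =
    g ^+ ratmap_deg Q * subst S (Q l).
  by rewrite (eq_subst _ SE) (subst_scale _ _ (ratmap_homog Q l)).
have nz_gq : g ^+ ratmap_deg Q != 0 by rewrite expf_neq0.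
apply: (mulfI nz_gq); rewrite mulrCA -gS [RHS]mulrCA -gS.
apply/eqP; rewrite -subr_eq0; apply/eqP.
apply: (@vanishing_on_domain _ _ P) => t Pt.
have Xt : on_surface X (eval_forms P t) by case: P_dominant => PX _; apply: PX.
have eval_lift l : (subst (fun l => subst P (r l)) (Q l)).@[t] =
    eval_forms Q (eval_forms r (eval_forms P t)) l.
  by rewrite meval_subst; apply: meval_eq => l'; rewrite meval_subst.
rewrite mevalB !mevalM !eval_lift.
case: (classic (nonzero_vec (eval_forms r (eval_forms P t)))) => [nz|z].
  have [c _ cE] := Qr Xt (conj nz (Q_nozero nz)).
  rewrite !cE /eval_forms mulrCA [in X in _ - X]mulrCA.
  by rewrite [_ * (P i).@[_]]mulrC subrr.
have rz l : eval_forms Q (eval_forms r (eval_forms P t)) l = 0.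
  rewrite /eval_forms (meval_eq (v2 := fun=> 0)).
    exact: homog_meval0 q_gt0 (ratmap_homog Q l).
  by move=> l'; apply/eqP; apply: contraT => nz; case: z; exists l'.
by rewrite !rz !mulr0 subrr.
Qed.

(** Proportional families that are both coprime differ by a unit. *)
Lemma composition_lift (S : ratmap K 2) g m : P m != 0 -> g != 0 ->
  (forall l, subst P (r l) = g * S l) ->
  exists2 c : K, c != 0 & forall i, subst S (Q i) = c *: P i.
Proof.
move=> nz_Pm nz_g SE.
have prop i : P m * subst S (Q i) = subst S (Q m) * P i.
  by rewrite (proportional_lift _ _ nz_g SE) mulrC.
have [k kE] := proportional_coprime_divides (@factorial_mpoly K 3) nz_Pm
  (@ratmap_coprime _ _ P) prop.
have QS i : subst S (Q i) = k * P i.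
  by apply: (mulfI nz_Pm); rewrite prop kE mulrAC mulrC.
have : k \is a GRing.unit.
  apply: (coprime_composition Q_nozero (@ratmap_coprime _ _ S)) => i.
  by exists (P i); rewrite QS mulrC.
case/andP => /eqP kC; rewrite unitfE => nz_k0.
by exists (k@_0) => // i; rewrite QS {1}kC mul_mpolyC.
Qed.

End Lift.

(** * Generic fibers *)

Section Fibers.
Variables (K : closedFieldType) (L : closedFieldType).
Variable iota : {rmorphism genfield K -> L}.
Local Notation ev f a := ((map_mpoly (const_emb iota) f).@[a]).

Lemma eval_generic (f : {mpoly K[3]}) :
  ev f (generic_point iota) = iota (tofrac f).
Proof.
apply: (mpoly_rmorph_eq
  (f := meval (generic_point iota) \o map_mpoly (const_emb iota))
  (g := iota \o @tofrac {mpoly K[3]})) f => [c|i] /=.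
  by rewrite map_mpolyC mevalC.
by rewrite map_mpolyX mevalXU.
Qed.

Lemma eval_generic_neq0 (f : {mpoly K[3]}) : f != 0 ->
  ev f (generic_point iota) != 0.
Proof. by move=> nz_f; rewrite eval_generic fmorph_eq0 tofrac_eq0. Qed.

Lemma eval_ext_homog n d (f : {mpoly K[n]}) (c : L) v w : f \is d.-homog ->
  (forall i, v i = c * w i) -> ev f v = c ^+ d * ev f w.
Proof.
move=> hf vw; rewrite (meval_eq _ vw); apply: meval_scale.
exact: map_mpoly_homog.
Qed.

(** If [S(a) = l S(h)], applying [Q] gives [P(a) = l^q P(h)]. If
    [P(a) = l P(h)], applying [r] gives [g(a) S(a) = l^e g(h) S(h)]; the right
    side is nonzero at a generic point [h], hence so is [g(a)]. *)
Lemma same_generic_fiber (P Q : ratmap K 3) (S : ratmap K 2) e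
    (r : 'I_3 -> {mpoly K[4]}) g (c : K) m :
  P m != 0 -> g != 0 -> c != 0 -> (forall i, r i \is e.-homog) ->
  (forall i, subst P (r i) = g * S i) ->
  (forall i, subst S (Q i) = c *: P i) ->
  in_SolSpace iota P S.
Proof.
move=> nz_Pm nz_g nz_c hr rE QE a; set h := generic_point iota.
have evr v i : ev g v * ev (S i) v = ev (r i) (eval_ext iota P v).
  by rewrite -mevalM -rmorphM -rE map_subst.
have evQ v i : const_emb iota c * ev (P i) v = ev (Q i) (eval_ext iota S v).
  by rewrite -map_subst QE map_mpolyZ mevalZ.
split=> -[nz_a nz_Ma [l nz_l E]].
  have PE i : ev (P i) a = l ^+ ratmap_deg Q * ev (P i) h.
    have nz_c' : const_emb iota c != 0 by rewrite fmorph_eq0.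
    apply: (mulfI nz_c'); rewrite evQ mulrCA evQ.
    exact: eval_ext_homog (ratmap_homog Q i) E.
  split=> //; last by exists (l ^+ ratmap_deg Q); rewrite ?expf_neq0.
  exists m; rewrite -[eval_ext _ _ _ _]/(ev (P m) a) PE.
  by rewrite mulf_neq0 ?expf_neq0 // eval_generic_neq0.
have SE i : ev g a * ev (S i) a = l ^+ e * (ev g h * ev (S i) h).
  by rewrite !evr; apply: eval_ext_homog (hr i) E.
have [i0 nz_i0] := coprime_family_neq0 (@ratmap_coprime _ _ S).
have := SE i0; have nz_gh : ev g h != 0 by apply: eval_generic_neq0.
have nz_Sh : ev (S i0) h != 0 by apply: eval_generic_neq0.
have nz_le : l ^+ e != 0 by apply: expf_neq0.
have nz_rhs : l ^+ e * (ev g h * ev (S i0) h) != 0.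
  by apply: mulf_neq0 => //; apply: mulf_neq0.
move=> SE0; have /andP[nz_ga nz_Sa] : (ev g a != 0) && (ev (S i0) a != 0).
  by rewrite -negb_or -mulf_eq0 SE0.
split=> //; first by exists i0.
exists (l ^+ e * ev g h / ev g a).
  by apply: mulf_neq0; [apply: mulf_neq0 | rewrite invr_eq0].
move=> i; apply: (mulfI nz_ga); rewrite [LHS]SE mulrA [RHS]mulrA; congr (_ * _).
by rewrite [RHS]mulrC divfK.
Qed.

End Fibers.

Theorem lemma6 (K : closedFieldType) (charK : [pchar K] =i pred0)
    (L : closedFieldType) (iota : {rmorphism genfield K -> L})
    (closL : algebraic_closure iota)
    (X : surface K) (P : ratmap K 3)
    (P4_neq0 : P ord_max != 0)
    (P_dominant : dominant_onto P X)
    (P_nonbirational : ~ birational_onto P X)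
    (X_param : exists Q : ratmap K 3,
       birational_onto Q X /\ without_base_points Q) :
  exists S : ratmap K 2,
    in_SolSpace iota P S /\
    (ratmap_deg S)%:R = (ratmap_deg P)%:R / sqrtC (surface_deg X)%:R :> algC.
Proof.
have [Q [[Q_dom [e [r [hr rQ_def rQ _ Qr]]]] Q_nozero]] := X_param.
have dX := surface_deg_square Q_dom hr rQ_def rQ Q_nozero.
have q_gt0 : (0 < ratmap_deg Q)%N.
  by have := surface_deg_gt0 X; rewrite dX expn_gt0 orbF.
have [S [g [nz_g SE]]] := inverse_lift P_dominant Q_dom hr rQ_def.
have [c nz_c QS] :=
  composition_lift P_dominant Q_nozero q_gt0 Qr P4_neq0 nz_g SE.
exists S; split.
  exact: same_generic_fiber P4_neq0 nz_g nz_c hr SE QS.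
have degP : ratmap_deg P = (ratmap_deg S * ratmap_deg Q)%N.
  have nz : c *: P ord_max != 0 by rewrite scaler_eq0 negb_or nz_c.
  apply: (dhomog_uniq nz); first exact: dhomogZ (ratmap_homog P _).
  by rewrite -QS; apply: subst_homog (ratmap_homog Q _); apply: ratmap_homog.
by rewrite dX natrX sqrCK ?ler0n // degP natrM mulfK // pnatr_eq0 -lt0n.
Qed.
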